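(* There exists a $2$-$(8,4,\lambda)_2$ design for every $\lambda\in\{63,84,147,168,189,252,273,294\}$, and there exists a $2$-$(10,4,\lambda)_2$ design for every $\lambda\in\{1785,1870,3570,3655,5355\}$.
   Context: For a $v$-dimensional vector space $V$ over the finite field $\mathrm{GF}(q)$, a pair $(V,\mathcal{B})$ with $\mathcal{B}$ a set of $k$-dimensional subspaces of $V$ (called blocks) is a $t$-$(v,k,\lambda)_q$ (subspace) design if every $t$-dimensional subspace of $V$ is contained in exactly $\lambda$ elements of $\mathcal{B}$. Here $q=2$. *)

(* Defs.v *)
From HB Require Import structures.
From mathcomp Require Import all_boot all_algebra.
From mathcomp Require Export finmap.

Set Implicit Arguments.
Unset Strict Implicit.
Unset Printing Implicit Defensive.

Local Open Scope fset_scope.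

(* The parameter q is not listed separately: it is #|F|. The blocks form a set,
   so there are no repeated blocks. *)
Definition subspace_design (F : finFieldType) (V : vectType F)
    (t v k lambda : nat) (B : {fset {vspace V}}) : Prop :=
  [/\ \dim {:V} = v,
      forall U : {vspace V}, U \in B -> \dim U = k
    & forall T : {vspace V}, \dim T = t ->
        #|` [fset U in B | (T <= U)%VS]| = lambda].

(* Main.v *)
(* A hyperplane W of V = W + F_2 has dimension n = 7 or 9, and the blocks are of two kinds:
   solids E (dimension 4) of W from a family EE, and the spaces spanned by a plane D
   (dimension 3) of W from a family DD together with a vector outside W.  A line meeting W
   in the point d only lies in one block for each D in DD through d, and a line T of W lies in
   2^(n - 3) blocks for each D in DD containing T and in the members of EE containing T.
   If DD is a 2-(n, 3, x) design, EE a 2-(n, 4, y) design, and 2^(n - 3) x + y is the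
   number of members of DD through a point, the blocks thus form a 2-(n + 1, 4) design; this
   happens for y = 5x, lambda = 21x when n = 7 and y = 21x, lambda = 85x when n = 9.

   It remains to have such designs for x in {3, 4, 7, 8, 9, 12, 13, 14} and
   x in {21, 22, 42, 43, 63}.  Those used here are invariant under the multiplicative
   group of the field with 2^n elements (a Singer cycle) and were found by computer search.
   By transitivity on points it is enough to enumerate the blocks through 1 and to count,
   for each t, those which contain t. *)

From HB Require Import structures.
Require Import Defs.
From Stdlib Require Import NArith.
From mathcomp Require Import all_boot all_algebra zify.

Set Implicit Arguments.
Unset Strict Implicit.
Unset Printing Implicit Defensive.

Import GRing.Theory.
Local Open Scope ring_scope.

(** * Designs on sets of vectors and designs of subspaces *)

(* A line {0, a, b, a + b} over F_2 lies in a subspace A iff a and b do, so lines are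
   represented by pairs of vectors and blocks by their sets of vectors. *)
Definition pair_design n (m lambda : nat) (B : {set {set 'rV['F_2]_n}}) : Prop :=
  (forall A, A \in B -> [/\ 0 \in A, {in A &, forall x y, x + y \in A} & #|A| = m]) /\
  (forall a b, a != 0 -> b != 0 -> a != b ->
     #|[set A in B | (a \in A) && (b \in A)]| = lambda).

Lemma F2_cases (c : 'F_2) : c = 0 \/ c = 1.
Proof. case: c => [[|[|m]] lt_m] //; [left | right]; exact: val_inj. Qed.

Lemma addxx n (x : 'rV['F_2]_n) : x + x = 0.
Proof. by apply/rowP => i; rewrite !mxE; case: (F2_cases (x ord0 i)) => ->; apply: val_inj. Qed.

Lemma oppx n (x : 'rV['F_2]_n) : - x = x.
Proof. by apply/eqP; rewrite eq_sym -addr_eq0 addxx. Qed.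

(** Coordinates in [vbasis U] identify the vectors of [U] with the functions from ['I_(\dim U)] to
    ['F_2]. *)
Lemma card_vs n (U : {vspace 'rV['F_2]_n}) : #|[set x in U]| = (2 ^ \dim U)%N.
Proof.
pose f (c : {ffun 'I_(\dim U) -> 'F_2}) := \sum_i c i *: (vbasis U)`_i.
have freeU := basis_free (vbasisP U).
have f_inj : injective f.
  move=> c d /eqP; rewrite -subr_eq0 -sumrB => /eqP eq_cd.
  apply/ffunP => i; apply/eqP; rewrite -subr_eq0; apply/eqP.
  move/freeP: freeU => /(_ (fun i => c i - d i)); apply.
  by rewrite -[RHS]eq_cd; apply: eq_bigr => j _; rewrite scalerBl.
have -> : [set x in U] = f @: setT.
  apply/setP => x; rewrite inE; apply/idP/imsetP => [xU | [c _ ->]]; last first.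
    apply: memv_suml => i _; apply: memvZ; apply: vbasis_mem.
    by apply: mem_nth; rewrite size_tuple.
  exists [ffun i => coord (vbasis U) i x] => //.
  rewrite {1}(coord_vbasis xU); by apply: eq_bigr => i _; rewrite ffunE.
by rewrite card_imset // cardsT card_ffun !card_ord.
Qed.

(** The only scalars are 0 and 1, so a set that contains 0 and is closed under sums is its own
    span. *)
Lemma mem_span_closed n (A : {set 'rV['F_2]_n}) :
  0 \in A -> {in A &, forall x y, x + y \in A} -> forall x, (x \in <<enum A>>%VS) = (x \in A).
Proof.
move=> A0 AD x; apply/idP/idP => [|xA]; last by rewrite memv_span // mem_enum.
move/coord_span=> ->; apply: (big_ind (fun y => y \in A)) => // i _.
move: (coord _ i x) => c; case: (F2_cases c) => ->; rewrite ?scale0r // scale1r.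
by rewrite -mem_enum mem_nth // -cardE.
Qed.

(** Each block is replaced with its span, which has the same vectors; hence distinct blocks give
    distinct subspaces. *)
Lemma subspace_design_of_pairs n k lambda (B : {set {set 'rV['F_2]_n}}) :
  pair_design (2 ^ k) lambda B ->
  exists (V : vectType 'F_2) (S : {fset {vspace V}}), subspace_design 2 n k lambda S.
Proof.
case=> Bsub Bcnt.
pose sp (A : {set 'rV['F_2]_n}) := <<enum A>>%VS.
have memsp A x : A \in B -> (x \in sp A) = (x \in A).
  by case/Bsub=> A0 AD _; apply: mem_span_closed.
have sp_inj : {in B &, injective sp}.
  by move=> A A' AB A'B eqA; apply/setP => x; rewrite -!memsp // eqA.
exists 'rV['F_2]_n, [fset sp A | A in B]%fset; split.
- by rewrite dimvf /dim /= mul1n.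
(* The dimension is recovered from the number of vectors, as [2 ^ d] determines [d]. *)
- move=> U /imfsetP[/= A AB ->]; apply/eqP; rewrite -(eqn_exp2l _ _ (ltnSn 1)) -card_vs.
  have -> : [set x in sp A] = A by apply/setP => x; rewrite inE memsp.
  by case: (Bsub _ AB) => _ _ ->.
move=> T dimT.
(* A basis of [T] provides the pair: freeness makes its two vectors nonzero and distinct. *)
have [a [b [a0 b0 a_b memT]]] : exists a b, [/\ a != 0, b != 0, a != b &
    forall A, A \in B -> (T <= sp A)%VS = (a \in A) && (b \in A)].
  have szT : size (vbasis T) = 2%N by rewrite size_tuple dimT.
  have := basis_free (vbasisP T); have := span_basis (vbasisP T).
  case: (tval (vbasis T)) szT => [|a [|b []]] //= _ spT.
  rewrite free_cons span_seq1 seq1_free => /andP[a_b b0].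
  exists a, b; split => // [||A AB].
  - by apply: contraNneq a_b => ->; apply: mem0v.
  - by apply: contraNneq a_b => ->; apply: memv_line.
  - by rewrite -spT span_cons span_seq1 subv_add -!memvE !memsp.
rewrite -(Bcnt a b a0 b0 a_b).
have -> : [fset U in [fset sp A | A in B] | (T <= U)%VS]%fset
    = [fset sp A | A in [set A in B | (a \in A) && (b \in A)]]%fset.
  apply/fsetP => U; rewrite !finmap.inE; apply/andP/imfsetP => /=.
    case=> /imfsetP[/= A AB ->]; rewrite memT // => aA; exists A => //.
    by rewrite inE AB.
  case=> A /=; rewrite inE => /andP[AB aA] ->; rewrite memT //; split => //.
  by apply/imfsetP; exists A.
rewrite card_in_imfset //= => [|A A']; last first.
  by rewrite !inE => /andP[AB _] /andP[A'B _]; apply: sp_inj.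
by rewrite cardE.
Qed.

Lemma card_imset_fibers (I J : finType) (f : I -> J) (A : {set I}) m :
  (forall x, x \in A -> #|[set y in A | f y == f x]| = m) -> #|A| = (#|f @: A| * m)%N.
Proof.
move=> fib; rewrite -sum1_card (partition_big_imset f) /= -sum_nat_const.
apply: eq_bigr => _ /imsetP[x xA ->]; rewrite -(fib x xA) -sum1_card.
by apply: eq_bigl => y; rewrite inE.
Qed.

(** * Extending designs by one dimension *)

Section Extension.
Variables (n k lambda : nat) (D E : {set {set 'rV['F_2]_n}}).
Notation W := 'rV['F_2]_n.
Notation V := 'rV['F_2]_(n + 1).

Definition hyp (x : V) : W := lsubmx x.
Definition hgt (x : V) : 'F_2 := rsubmx x ord0 ord0.

(* [locked] keeps [inE] from unfolding the two kinds of blocks. *)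
Definition flat (A : {set W}) : {set V} := locked [set x | (hgt x == 0) && (hyp x \in A)].
Definition tilt (A : {set W}) (c : W) : {set V} := locked [set x | hyp x + hgt x *: c \in A].

Definition extension : {set {set V}} :=
  [set flat A | A in E] :|: [set tilt p.1 p.2 | p in setX D setT].

(** * Coordinates on [V]: component in the hyperplane and height *)

Lemma hypD x y : hyp (x + y) = hyp x + hyp y. Proof. exact: linearD. Qed.
Lemma hgtD x y : hgt (x + y) = hgt x + hgt y. Proof. by rewrite /hgt linearD mxE. Qed.
Lemma hyp_row w (a : 'rV['F_2]_1) : hyp (row_mx w a) = w. Proof. exact: row_mxKl. Qed.
Lemma hgt_row w a : hgt (row_mx w a%:M) = a.
Proof. by rewrite /hgt row_mxKr mxE eqxx mulr1n. Qed.
Lemma hyp_hgt_inj x y : hyp x = hyp y -> hgt x = hgt y -> x = y.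
Proof.
move=> eql eqr; rewrite -[x]hsubmxK -[y]hsubmxK; congr row_mx => //.
by apply/rowP => i; rewrite (ord1 i).
Qed.

Definition lift0 (w : W) : V := row_mx w (0 : 'F_2)%:M.
Definition lift1 (w : W) : V := row_mx w (1 : 'F_2)%:M.

Lemma lift0_flat A w : (lift0 w \in flat A) = (w \in A).
Proof. by rewrite /flat /tilt -lock inE hyp_row hgt_row eqxx. Qed.
Lemma lift0_tilt A c w : (lift0 w \in tilt A c) = (w \in A).
Proof. by rewrite /flat /tilt -lock inE hyp_row hgt_row scale0r addr0. Qed.
Lemma lift1_flat A w : (lift1 w \in flat A) = false.
Proof. by rewrite /flat /tilt -lock inE hgt_row. Qed.
Lemma lift1_tilt A c w : (lift1 w \in tilt A c) = (w + c \in A).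
Proof. by rewrite /flat /tilt -lock inE hyp_row hgt_row scale1r. Qed.

Lemma liftP x : {w | x = lift0 w} + {w | x = lift1 w}.
Proof.
case: (boolP (hgt x == 0)) => [/eqP x0 | x1]; [left | right]; exists (hyp x).
  by apply: hyp_hgt_inj; rewrite ?hyp_row ?hgt_row.
apply: hyp_hgt_inj; rewrite ?hyp_row ?hgt_row //.
by case: (F2_cases (hgt x)) x1 => // ->; rewrite eqxx.
Qed.

Lemma lift0_inj : injective lift0. Proof. by move=> a b /(congr1 hyp); rewrite !hyp_row. Qed.
Lemma lift1_inj : injective lift1. Proof. by move=> a b /(congr1 hyp); rewrite !hyp_row. Qed.
Lemma lift0D a b : lift0 a + lift0 b = lift0 (a + b).
Proof. by apply: hyp_hgt_inj; rewrite ?hypD ?hgtD ?hyp_row ?hgt_row ?addr0. Qed.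
Lemma lift1D a b : lift1 a + lift1 b = lift0 (a + b).
Proof. by apply: hyp_hgt_inj; rewrite ?hypD ?hgtD ?hyp_row ?hgt_row //; apply: val_inj. Qed.
Lemma lift01D a b : lift0 a + lift1 b = lift1 (a + b).
Proof. by apply: hyp_hgt_inj; rewrite ?hypD ?hgtD ?hyp_row ?hgt_row ?add0r. Qed.
Lemma lift10D a b : lift1 a + lift0 b = lift1 (a + b).
Proof. by rewrite addrC lift01D addrC. Qed.
Lemma lift00 : lift0 0 = 0.
Proof. by apply: hyp_hgt_inj; rewrite ?hyp_row ?hgt_row /hyp /hgt ?linear0 ?mxE. Qed.

Definition liftE := (lift0_flat, lift0_tilt, lift1_flat, lift1_tilt).

(** * Counting the blocks of the extension *)

Hypothesis le_kn : (k <= n)%N.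
Hypothesis subD : forall A, A \in D ->
  [/\ 0 \in A, {in A &, forall x y, x + y \in A} & #|A| = (2 ^ k)%N].
Hypothesis subE : forall A, A \in E ->
  [/\ 0 \in A, {in A &, forall x y, x + y \in A} & #|A| = (2 ^ k.+1)%N].
Hypothesis pointD : forall a, a != 0 -> #|[set A in D | a \in A]| = lambda.
Hypothesis pairDE : forall a b, a != 0 -> b != 0 -> a != b ->
  (2 ^ (n - k) * #|[set A in D | (a \in A) && (b \in A)]|
   + #|[set A in E | (a \in A) && (b \in A)]|)%N = lambda.

Lemma addIl m (A : {set 'rV['F_2]_m}) x y : {in A &, forall x y, x + y \in A} -> x \in A ->
  (x + y \in A) = (y \in A).
Proof.
move=> AD xA; apply/idP/idP => yA; last exact: AD.
by rewrite -[y]add0r -(addxx x) -addrA AD.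
Qed.

Lemma flat_inj : injective flat.
Proof. by move=> A A' eqA; apply/setP => w; rewrite -!lift0_flat eqA. Qed.

(** [tilt A c] is spanned by the copy of [A] at height 0 and the vector [lift1 c], so it determines
    [A], and [c] modulo [A]. *)
Lemma tilt_eq A c A' c' : A \in D -> A' \in D ->
  (tilt A c == tilt A' c') = (A == A') && (c + c' \in A).
Proof.
move=> /subD[A0 AD _] /subD[A'0 A'D _]; apply/eqP/andP.
  move=> eqt; have eqA : A = A' by apply/setP => w; rewrite -(lift0_tilt A c) eqt lift0_tilt.
  split; first exact/eqP.
  have : lift1 c \in tilt A' c' by rewrite -eqt lift1_tilt addxx.
  by rewrite lift1_tilt eqA.
case=> /eqP <- cA; apply/setP => x; case: (liftP x) => [[w ->] | [w ->]]; rewrite !liftE //.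
by rewrite -(@addIl _ A (c + c') (w + c)) // [c + c']addrC addrACA addxx addr0 addrC.
Qed.

Lemma card_flat A : #|flat A| = #|A|.
Proof.
rewrite -(card_imset _ lift0_inj); congr #|pred_of_set _|; apply/setP => x.
case: (liftP x) => [[w ->] | [w ->]]; rewrite liftE.
  by rewrite mem_imset //; apply: lift0_inj.
by apply/esym/negbTE/imsetP => -[v _ /(congr1 hgt)]; rewrite !hgt_row.
Qed.

(** There are two layers: a copy of [A] at height 0 and its translate by [c] at height 1. *)
Lemma card_tilt A c : #|tilt A c| = (#|A| * 2)%N.
Proof.
have -> : tilt A c = lift0 @: A :|: (fun w => lift1 (w + c)) @: A.
  apply/setP => x; rewrite in_setU; case: (liftP x) => [[w ->] | [w ->]]; rewrite liftE.
    rewrite mem_imset; last exact: lift0_inj.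
    by rewrite orbC; case: imsetP => // -[v _ /(congr1 hgt)]; rewrite !hgt_row.
  case: imsetP => [[v _ /(congr1 hgt)]|_ /=]; first by rewrite !hgt_row.
  apply/idP/imsetP => [wA | [v vA /lift1_inj->]]; last by rewrite -addrA addxx addr0.
  by exists (w + c) => //; rewrite -addrA addxx addr0.
rewrite cardsU (card_imset _ lift0_inj) card_imset => [|a b /lift1_inj/addIr //].
rewrite (_ : _ :&: _ = set0) ?cards0 ?subn0 ?muln2 ?addnn //.
apply/setP => x; rewrite !inE; apply/negbTE/andP => -[/imsetP[v _ ->]].
by case/imsetP => w _ /(congr1 hgt); rewrite !hgt_row.
Qed.

(** The two kinds of blocks never coincide: [tilt C c] contains [lift1 c], while a flat block has no
    vector of height 1. *)
Lemma card_extension (P : pred {set V}) :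
  #|[set A in extension | P A]| =
  (#|[set A in E | P (flat A)]| +
   #|[set tilt p.1 p.2 | p in [set p in setX D setT | P (tilt p.1 p.2)]]|)%N.
Proof.
rewrite -(card_imset [set A in E | P (flat A)] flat_inj).
set X := flat @: _; set Y := _ @: _.
have XY0 : X :&: Y = set0.
  apply/setP => A; rewrite !inE; apply/negbTE/andP => -[/imsetP[B]].
  rewrite inE => /andP[BE _] -> /imsetP[[C c]]; rewrite !inE /= => /andP[/andP[CD _] _].
  move/setP/(_ (lift1 c)); rewrite !liftE addxx.
  by case: (subD CD) => ->.
rewrite -cardsUI XY0 cards0 addn0; congr #|pred_of_set _|; apply/setP => A; rewrite !inE.
apply/andP/orP.
  case=> /orP[] /imsetP[B B_in ->] PB; [left | right]; apply/imsetP;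
    by exists B => //; rewrite inE B_in.
by case=> /imsetP[B]; rewrite inE => /andP[B_in PB] ->; split => //; apply/orP;
  [left | right]; exact: imset_f.
Qed.

(** Two vectors of height 0 are counted by [pairDE]; in the other cases their line meets the
    hyperplane in a single point, and [pointD] applies there. *)
Lemma extension_pair_design : pair_design (2 ^ k.+1) lambda extension.
Proof.
have ext_sub A : A \in extension ->
    [/\ 0 \in A, {in A &, forall x y, x + y \in A} & #|A| = (2 ^ k.+1)%N].
  rewrite inE => /orP[/imsetP[B BE ->] | /imsetP[[B c]]].
    case: (subE BE) => B0 BD cB; split; last by rewrite card_flat.
      by rewrite -lift00 liftE.
    move=> x y; case: (liftP x) => [[v ->] | [v ->]]; rewrite !liftE //.
    by case: (liftP y) => [[w ->] | [w ->]]; rewrite !liftE // lift0D liftE; apply: BD.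
  rewrite !inE andbT /= => /subD[B0 BD cB] ->; split; last by rewrite card_tilt cB expnSr.
    by rewrite -lift00 liftE.
  move=> x y; case: (liftP x) => [[v ->] | [v ->]]; case: (liftP y) => [[w ->] | [w ->]];
    rewrite ?(lift0D, lift1D, lift01D, lift10D) !liftE => vB wB.
  - exact: BD.
  - by rewrite -addrA BD.
  - by rewrite addrAC BD.
  - by rewrite -[v + w]addr0 -(addxx c) addrACA BD.
split=> //.
have cnt00 a b : a != 0 -> b != 0 -> a != b ->
    #|[set A in extension | (lift0 a \in A) && (lift0 b \in A)]| = lambda.
  move=> a0 b0 a_b; rewrite card_extension -(pairDE a0 b0 a_b) addnC; congr addn; last first.
    by apply: eq_card => A; rewrite !inE !liftE.
  (* Each tilted block comes from [2 ^ k] pairs, [c] running over a coset of [A]. The [2 ^ n]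
     choices of [c] thus give [2 ^ (n - k)] blocks for each [A]. *)
  apply/eqP; rewrite -(eqn_pmul2r (expn_gt0 2 k)) -card_imset_fibers.
    rewrite mulnAC -expnD subnK // mulnC.
    rewrite (_ : [set p in _ | _] = setX [set A in D | (a \in A) && (b \in A)] setT).
      by rewrite cardsX cardsT card_mx mul1n card_ord.
    by apply/setP => -[A c]; rewrite !inE !liftE !andbT.
  case=> A c; rewrite !inE !liftE /= andbT => /andP[AD abA].
  case: (subD AD) => _ _ <-.
  have inj_c : injective (fun w => (A, c + w)) by move=> v w [/addrI].
  rewrite -(card_imset _ inj_c); congr #|pred_of_set _|; apply/setP => -[A' c'].
  rewrite !inE !liftE /= andbT.
  apply/idP/imsetP => [/andP[/andP[A'D _]] | [w wA [-> ->]]].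
    rewrite tilt_eq // => /andP[/eqP-> cc']; exists (c' + c) => //.
    by rewrite [c' + c]addrC addrA addxx add0r.
  by rewrite AD abA tilt_eq // eqxx addrAC addxx add0r wA.
(* A block [tilt A c] through [lift1 a] has [a + c] in [A], hence equals [tilt A a]: there is one
   block for each [A] through [d]. *)
have cnt01 d a : d != 0 ->
    #|[set A in extension | (lift0 d \in A) && (lift1 a \in A)]| = lambda.
  move=> d0; rewrite card_extension -(pointD d0).
  rewrite (_ : [set A in E | _] = set0) ?cards0 ?add0n; last first.
    by apply/setP => A; rewrite !inE !liftE /= andbF andbF.
  rewrite -(card_in_imset (f := fun A => tilt A a)); last first.
    move=> A A'; rewrite !inE => /andP[AD _] /andP[A'D _] /eqP.
    by rewrite tilt_eq // => /andP[/eqP].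
  congr #|pred_of_set _|; apply/setP => X; apply/imsetP/imsetP => -[].
    case=> A c; rewrite !inE !liftE /= andbT => /andP[AD /andP[dA acA]] ->.
    by exists A; rewrite ?inE ?AD //; apply/eqP; rewrite tilt_eq // eqxx addrC.
  move=> A; rewrite inE => /andP[AD dA] ->; exists (A, a) => //.
  rewrite !inE !liftE /= AD dA addxx.
  by case: (subD AD) => ->.
move=> a b; case: (liftP a) => [[v ->] | [v ->]]; case: (liftP b) => [[w ->] | [w ->]].
- by rewrite -lift00 !(inj_eq lift0_inj); apply: cnt00.
- by rewrite -lift00 (inj_eq lift0_inj) => v0 _ _; apply: cnt01.
- rewrite -lift00 (inj_eq lift0_inj) => _ w0 _; rewrite -(cnt01 w v) //.
  by apply: eq_card => A; rewrite !inE andbCA andbC -andbA; congr andb; rewrite andbC.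
(* The line through [lift1 v] and [lift1 w] has [lift0 (v + w)] as its third point, which replaces
   [lift1 v]. *)
- rewrite (inj_eq lift1_inj) => _ _ v_w.
  rewrite -(cnt01 (v + w) w); last by rewrite -(oppx w) subr_eq0.
  apply: eq_card => A; rewrite !inE.
  case: (boolP (lift1 w \in A)) => wA; rewrite ?andbF // !andbT.
  apply: andb_id2l => Aext; case: (ext_sub A) => [|_ AD _]; first by rewrite inE.
  by rewrite -lift1D addrC addIl.
Qed.
End Extension.

(** * Families of subspaces invariant under a Singer cycle *)

Definition bit (a : N) (i : nat) : bool := N.testbit a (N.of_nat i).
(** Under this coding, addition of vectors is [N.lxor], so that the families can be checked on [N]
    by [vm_compute]. *)
Definition dec n (a : N) : 'rV['F_2]_n := \row_(i < n) (bit a i)%:R.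

Lemma dec0 n : dec n 0 = 0.
Proof. by apply/rowP => i; rewrite !mxE. Qed.

Lemma dec_lxor n a b : dec n (N.lxor a b) = dec n a + dec n b.
Proof.
apply/rowP => i; rewrite !mxE /bit N.lxor_spec.
by case: N.testbit; case: N.testbit; apply: val_inj.
Qed.

Lemma bit_high n a i : (a < 2 ^ N.of_nat n)%num -> (n <= i)%N -> bit a i = false.
Proof.
move=> lt_a le_ni; rewrite /bit -(N.mod_small _ _ lt_a) N.mod_pow2_bits_high //; lia.
Qed.

Lemma dec_inj n a b : (a < 2 ^ N.of_nat n)%num -> (b < 2 ^ N.of_nat n)%num ->
  dec n a = dec n b -> a = b.
Proof.
move=> lta ltb /rowP eq_ab; apply: N.bits_inj => i; rewrite -(N2Nat.id i).
case: (ltnP (N.to_nat i) n) => [lt_in | le_ni]; last first.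
  by have := bit_high lta le_ni; have := bit_high ltb le_ni; rewrite /bit => -> ->.
have := eq_ab (Ordinal lt_in); rewrite !mxE /bit /=.
by case: N.testbit; case: N.testbit => // /(congr1 val).
Qed.

(** The list has repetitions if [b] is dependent. Its head is the empty sum 0, which [behead]
    removes later. *)
Fixpoint xor_span (b : seq N) : seq N :=
  if b is x :: b' then let s := xor_span b' in s ++ map (N.lxor x) s else [:: 0%num].

Lemma size_xor_span b : size (xor_span b) = (2 ^ size b)%N.
Proof. by elim: b => //= x b IH; rewrite size_cat size_map IH addnn expnS mul2n. Qed.

Lemma xor_span_behead b : xor_span b = 0%num :: behead (xor_span b).
Proof. by elim: b => //= x b ->. Qed.

Lemma xor_span_lxor b : {in xor_span b &, forall x y, N.lxor x y \in xor_span b}.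
Proof.
elim: b => [|z b IH] x y /=; first by rewrite !inE => /eqP-> /eqP->.
rewrite !mem_cat => /orP[xb | /mapP[x' xb ->]] /orP[yb | /mapP[y' yb ->]].
- by rewrite IH.
- rewrite -N.lxor_assoc (N.lxor_comm x) N.lxor_assoc map_f ?orbT //; exact: IH.
- rewrite N.lxor_assoc map_f ?orbT //; exact: IH.
- rewrite (N.lxor_comm z y') N.lxor_assoc -(N.lxor_assoc x') (N.lxor_comm (N.lxor x' y')).
  by rewrite -N.lxor_assoc N.lxor_nilpotent N.lxor_0_l IH.
Qed.

(** * The Singer cycle: multiplication by x *)

Section Cyclic.
Variables (m : nat) (poly period : N).
Notation n := m.+1.
Notation W := 'rV['F_2]_n.
Notation M := (N.to_nat period).

(* Vectors are the elements of F_2[x]/(poly), bit i being the coefficient of x^i (poly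
   includes its leading bit); [step] on codes and [sigma] on vectors multiply by x. *)
Definition step (a : N) : N :=
  if bit a m then N.lxor (N.double a) poly else N.double a.

Definition sigma (v : W) : W :=
  \row_(i < n) ((if val i is j.+1 then v ord0 (inord j) else 0)
                 + v ord0 ord_max * (bit poly i)%:R).

Lemma sigmaD v w : sigma (v + w) = sigma v + sigma w.
Proof.
apply/rowP => i; rewrite !mxE mulrDl.
by case: (val i) => [|j]; rewrite ?mxE addrACA ?addr0.
Qed.

Lemma sigma0 : sigma 0 = 0.
Proof. by apply/rowP => i; rewrite !mxE mul0r addr0; case: (val i) => [|j]; rewrite ?mxE. Qed.

Lemma dec_step a : dec n (step a) = sigma (dec n a).
Proof.
have dbl i : bit (N.double a) i = if i is j.+1 then bit a j else false.
  case: i => [|i]; rewrite /bit; first by case: a.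
  by rewrite Nat2N.inj_succ N.double_bits_succ.
apply/rowP => i; rewrite !mxE /step.
have -> : (if val i is j.+1 then dec n a ord0 (inord j) else 0)
    = (bit (N.double a) i)%:R :> 'F_2.
  rewrite dbl; case: i => [[|j] lt_j] //=; rewrite mxE inordK //; exact: ltnW.
case: (boolP (bit a m)) => am; rewrite ?mul0r ?addr0 ?mul1r //.
rewrite /bit N.lxor_spec.
by case: N.testbit; case: N.testbit; apply: val_inj.
Qed.

(** Primitivity of [poly] as a finite computation: the powers of x run through all nonzero codes of
    [n] bits before returning to 1. *)
Definition primitive : bool :=
  let s := traject step 1%num M in
  [&& period == (2 ^ N.of_nat n - 1)%num, iter M step 1%num == 1%num, uniq s
    & all (fun a => (0 <? a) && (a <? 2 ^ N.of_nat n))%num s].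

(** This is the power x^i; exponents serve as discrete logarithms throughout. *)
Definition pt (i : nat) : W := iter i sigma (dec n 1).

Lemma pt_dec i : pt i = dec n (iter i step 1%num).
Proof. by elim: i => //= i IH; rewrite dec_step -IH. Qed.

Lemma ptD i j : pt (i + j) = iter i sigma (pt j).
Proof. by rewrite /pt iterD. Qed.

Hypothesis prim : primitive.

Lemma codeP i : (i < M)%N ->
  (0 < iter i step 1 < 2 ^ N.of_nat n)%num.
Proof.
move=> lt_i; case/and4P: prim => _ _ _ /allP/(_ (iter i step 1%num)).
rewrite -(nth_traject _ lt_i) mem_nth ?size_traject // => /(_ isT).
by case/andP => /N.ltb_lt ? /N.ltb_lt.
Qed.

Lemma pt_inj i j : (i < M)%N -> (j < M)%N -> pt i = pt j -> i = j.
Proof.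
move=> lti ltj; rewrite !pt_dec => /dec_inj eq_ij.
have [_ lt1] := codeP lti; have [_ lt2] := codeP ltj.
case/and4P: prim => _ _ us _; apply/eqP.
rewrite -(nth_uniq 1%num _ _ us) ?size_traject // !nth_traject //.
by rewrite eq_ij.
Qed.

Lemma pt_neq0 i : (i < M)%N -> pt i != 0.
Proof.
move=> lti; have [gt0 lt] := codeP lti.
apply/eqP; rewrite pt_dec -(dec0 n) => /dec_inj-/(_ lt) eq0.
by rewrite eq0 in gt0; lia.
Qed.

Lemma period_gt0 : (0 < M)%N.
Proof.
case/and4P: prim => /eqP -> _ _ _.
have : (1 < 2 ^ N.of_nat n)%num by apply: N.pow_gt_1; lia.
lia.
Qed.

Lemma card_period : M = (2 ^ n - 1)%N.
Proof.
case/and4P: prim => /eqP -> _ _ _.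
suff : N.to_nat (2 ^ N.of_nat n) = (2 ^ n)%N by lia.
elim: (n) => // k IH; rewrite Nat2N.inj_succ N.pow_succ_r' expnS -IH; lia.
Qed.

(** The first [2 ^ n - 1] powers of x are distinct and nonzero, so they exhaust the nonzero
    vectors. *)
Lemma ptP v : v != 0 -> exists2 i, (i < M)%N & v = pt i.
Proof.
move=> v0; pose S := [set pt i | i : 'I_M].
have : v \in S.
  suff -> : S = [set~ 0] by rewrite !inE.
  apply/eqP; rewrite eqEcard; apply/andP; split.
    by apply/subsetP => _ /imsetP[i _ ->]; rewrite !inE pt_neq0.
  rewrite card_imset => [|i j /pt_inj eq_ij]; last by apply: val_inj; apply: eq_ij.
  by rewrite cardsC1 card_mx mul1n !card_ord card_period subn1.
by case/imsetP => i _ ->; exists i.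
Qed.

(** By [ptP] a nonzero vector is a power of x, and the powers have period [M]. *)
Lemma sigma_period v : iter M sigma v = v.
Proof.
have it0 : iter M sigma 0 = 0 by elim: M => //= k ->; rewrite sigma0.
case: (eqVneq v 0) => [-> // | /ptP[i _ ->]].
rewrite -ptD addnC ptD; congr iter; rewrite pt_dec.
by case/and4P: prim => _ /eqP-> _ _.
Qed.

Lemma sigma_inj : injective sigma.
Proof.
move=> v w eq_vw; rewrite -[v]sigma_period -[w]sigma_period.
by rewrite -(prednK period_gt0) !iterSr eq_vw.
Qed.

(** * Blocks given by exponents, and their translates under the cycle *)

(* The subspace whose nonzero vectors are the powers of x with exponents in [s]. *)
Definition block (s : seq N) : {set W} := [set:: 0 :: [seq pt (N.to_nat l) | l <- s]].

Definition logs_ok (s : seq N) := uniq s && all (fun l => l <? period)%num s.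

Lemma ltM l s : logs_ok s -> l \in s -> (N.to_nat l < M)%N.
Proof. by case/andP=> _ /allP lt_s /lt_s /N.ltb_lt; lia. Qed.

Lemma mem_block s l : logs_ok s -> (l < period)%num ->
  (pt (N.to_nat l) \in block s) = (l \in s).
Proof.
move=> ok ltl; have lt : (N.to_nat l < M)%N by lia.
rewrite inE in_cons (negbTE (pt_neq0 lt)) /=.
apply/mapP/idP => [[l' l's /pt_inj eq_l] | ls]; last by exists l.
have -> // : l = l' by apply: N2Nat.inj; apply: eq_l => //; apply: ltM l's.
Qed.

Lemma card_block s : logs_ok s -> #|block s| = (size s).+1.
Proof.
move=> ok; rewrite cardsE (card_uniqP _) /= ?size_map //.
apply/andP; split.
  by apply/mapP => -[l ls /eqP]; rewrite eq_sym (negbTE (pt_neq0 (ltM ok ls))).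
rewrite map_inj_in_uniq; first by case/andP: ok.
by move=> l l' ls l's /pt_inj eq_l; apply: N2Nat.inj; apply: eq_l; apply: ltM ok _.
Qed.

Definition shift (j : nat) (A : {set W}) : {set W} := iter j sigma @: A.

Lemma iter_sigma_inj j : injective (iter j sigma).
Proof. by elim: j => [|j IH] v w //= /sigma_inj/IH. Qed.

Lemma shiftD i j A : shift i (shift j A) = shift (i + j) A.
Proof. by rewrite /shift -imset_comp; apply: eq_imset => v /=; rewrite iterD. Qed.

Lemma shift_period A : shift M A = A.
Proof. by rewrite /shift (eq_imset _ sigma_period) imset_id. Qed.

Lemma shiftM q j A : shift (q * M + j) A = shift j A.
Proof. by elim: q => // q IH; rewrite mulSn -addnA -shiftD shift_period. Qed.

Lemma mem_shift j v A : (iter j sigma v \in shift j A) = (v \in A).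
Proof. by rewrite mem_imset //; apply: iter_sigma_inj. Qed.

Lemma block_map j s s' :
  [seq pt (N.to_nat l) | l <- s'] = [seq iter j sigma (pt (N.to_nat l)) | l <- s] ->
  block s' = shift j (block s).
Proof.
move=> eqs; have it0 : iter j sigma 0 = 0 by elim: j {eqs} => //= k ->; rewrite sigma0.
apply/setP => v; rewrite inE in_cons eqs; apply/idP/imsetP.
  case/orP => [/eqP-> | /mapP[l ls ->]]; first by exists 0; rewrite // inE in_cons eqxx.
  exists (pt (N.to_nat l)) => //; rewrite inE in_cons; apply/orP; right.
  by apply/mapP; exists l.
case=> w; rewrite inE in_cons => /orP[/eqP-> | /mapP[l ls ->]] ->; rewrite ?it0 ?eqxx //.
by apply/orP; right; apply/mapP; exists l.
Qed.

(* Division by x^u on exponents: [l - u] modulo the period. *)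
Definition derot (u l : N) : N :=
  if (u <=? l)%num then (l - u)%num else (l + period - u)%num.

Lemma derot_lt u l : (l < period)%num -> (u < period)%num -> (derot u l < period)%num.
Proof. by rewrite /derot; case: N.leb_spec0; lia. Qed.

Lemma pt_derot u l : (u < period)%num ->
  iter (N.to_nat u) sigma (pt (N.to_nat (derot u l))) = pt (N.to_nat l).
Proof.
move=> ltu; rewrite -ptD /derot; case: N.leb_spec0 => le_ul.
  by congr pt; lia.
have -> : (N.to_nat u + N.to_nat (l + period - u) = N.to_nat l + M)%N by lia.
by rewrite addnC ptD sigma_period.
Qed.

Lemma derot_ok u s : (u < period)%num -> logs_ok s -> logs_ok (map (derot u) s).
Proof.
move=> ltu /andP[us /allP lts]; apply/andP; split.
  rewrite map_inj_in_uniq // => l l' /lts/N.ltb_lt ltl /lts/N.ltb_lt ltl'.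
  by rewrite /derot; do 2!case: N.leb_spec0; lia.
by apply/allP => _ /mapP[l /lts/N.ltb_lt ltl ->]; apply/N.ltb_lt/derot_lt.
Qed.

Lemma block_derot u s : (u < period)%num ->
  block s = shift (N.to_nat u) (block (map (derot u) s)).
Proof.
by move=> ltu; apply: block_map; rewrite -map_comp; apply: eq_map => l /=; rewrite pt_derot.
Qed.

(** A translate of a block contains 1 exactly when it is the quotient of the block by one of its
    vectors, so these are the members of the orbit through 1, possibly repeated. *)
Definition derots (s : seq N) : seq (seq N) := [seq map (derot u) s | u <- s].

(** * Counting in a union of orbits *)

(* [S] holds orbit representatives and [C] lists, without repetition, the blocks of their
   orbits that contain 1. *)
Section Family.
Variables (S C : seq (seq N)).
Hypothesis okS : all logs_ok S.
Hypothesis okC : all logs_ok C.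
Hypothesis C_S : forall c, c \in C ->
  exists2 s, s \in S & exists2 u, u \in s & block c = block (map (derot u) s).
Hypothesis S_C : forall s u, s \in S -> u \in s ->
  exists2 c, c \in C & block c = block (map (derot u) s).
Hypothesis uniqC : uniq (map block C).

Definition orbits : {set {set W}} :=
  locked [set A | has (fun s => [exists j : 'I_M, A == shift j (block s)]) S].

Lemma orbitsP A :
  reflect (exists2 s, s \in S & exists j, A = shift j (block s)) (A \in orbits).
Proof.
rewrite /orbits -lock inE; apply: (iffP hasP) => -[s sS].
  by case/existsP=> j /eqP->; exists s => //; exists j.
case=> j ->; exists s => //; apply/existsP; exists (Ordinal (ltn_pmod j period_gt0)).
by rewrite /= {1}(divn_eq j M) shiftM.
Qed.

Lemma orbits_shift j A : (shift j A \in orbits) = (A \in orbits).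
Proof.
apply/orbitsP/orbitsP => -[s sS [i eqA]]; exists s => //; last first.
  by exists (j + i)%N; rewrite eqA shiftD.
(* Translation by [j * M.-1] inverts translation by [j], since [j * M] acts trivially. *)
exists (j * M.-1 + i)%N; rewrite -shiftD -eqA shiftD -mulnSr prednK ?period_gt0 //.
by rewrite -[(j * M)%N]addn0 shiftM /shift imset_id.
Qed.

Lemma orbits_through (P : pred {set W}) :
  #|[set A in orbits | (pt 0 \in A) && P A]| = count (P \o block) C.
Proof.
have -> : [set A in orbits | (pt 0 \in A) && P A] = [set:: filter P (map block C)].
  apply/setP => A; rewrite !inE mem_filter andbA andbC; congr andb.
  apply/andP/mapP => [[Af A1] | [c cC ->]].
    case/orbitsP: Af A1 => s sS [j ->] => /imsetP[v].
    rewrite inE in_cons => /orP[/eqP-> eq0 | /mapP[u us ->] eq1].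
      have it0 : iter j sigma 0 = 0 by elim: (j) => //= k ->; rewrite sigma0.
      by have := pt_neq0 period_gt0; rewrite eq0 it0 eqxx.
    have ltu : (u < period)%num.
      by have /andP[_ /allP/(_ _ us)/N.ltb_lt] := allP okS _ sS.
    have [c cC eqc] := S_C sS us; exists c => //.
    (* The member is the translate by [j + u] of the quotient of [block s] by x^u. As x^(j + u) = 1,
       this exponent is a multiple of [M], and the member is the quotient itself. *)
    rewrite (block_derot s ltu) -eqc shiftD.
    have : pt (j + N.to_nat u) = pt 0 by rewrite ptD -eq1.
    have [q [r [ltr ->]]] : exists q r, (r < M)%N /\ (j + N.to_nat u = q * M + r)%N.
      exists ((j + N.to_nat u) %/ M)%N, ((j + N.to_nat u) %% M)%N.
      by rewrite ltn_pmod ?period_gt0 // -divn_eq.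
    rewrite shiftM.
    have -> : pt (q * M + r) = pt r.
      by elim: q => // q IH; rewrite mulSn -addnA ptD sigma_period.
    by move/pt_inj => -> //; rewrite ?period_gt0 // /shift imset_id.
  have [s sS [u us eqc]] := C_S cC.
  have /andP[_ /allP/(_ _ us)/N.ltb_lt ltu] := allP okS _ sS.
  split; last first.
    rewrite eqc inE in_cons -map_comp (_ : pt 0 = (pt \o N.to_nat \o derot u) u).
      by rewrite map_f ?orbT.
    by rewrite /= /derot N.leb_refl N.sub_diag.
  have : block s \in orbits by apply/orbitsP; exists s => //; exists 0; rewrite /shift imset_id.
  by rewrite (block_derot s ltu) orbits_shift eqc.
rewrite cardsE (card_uniqP _) ?filter_uniq // size_filter count_map.
by apply: eq_count.
Qed.

(** Division by [a] preserves the family and moves the pair to 1 and b/a; the witness [l] is the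
    logarithm of b/a. *)
Lemma orbits_count a b : a != 0 -> b != 0 ->
  exists2 l, (l < period)%num /\ (l = 0%num <-> a = b) &
    #|[set A in orbits | (a \in A) && (b \in A)]| = count (fun c => l \in c) C.
Proof.
case/ptP=> i lti ->{a} /ptP[j ltj ->]{b}.
(* [M - i] stands for [- i] modulo [M], which avoids a truncated subtraction. *)
pose d := (j + (M - i))%N; exists (N.of_nat (d %% M)).
  have := ltn_pmod d period_gt0; split; first lia.
  split=> [eq0 | /pt_inj eq_ij].
    (* As [0 < d < 2 * M], the only possible multiple of [M] is [M] itself, whence [i = j]. *)
    congr pt; have : (d %% M)%N = 0%N by lia.
    move/eqP/dvdnP=> [q]; rewrite /d.
    by case: q => [|[|q]]; rewrite ?mul0n ?mul1n ?mulSn; lia.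
  by rewrite /d eq_ij // subnKC ?modnn // ltnW.
pose f := shift (M - i).
have f_inj : injective f by apply: imset_inj; apply: iter_sigma_inj.
rewrite -(card_imset _ f_inj).
have pM k : pt (k + M) = pt k by rewrite addnC ptD sigma_period.
have p0 : iter (M - i) sigma (pt i) = pt 0 by rewrite -ptD subnK ?(ltnW lti) // -(pM 0).
have pd : iter (M - i) sigma (pt j) = pt (d %% M).
  rewrite -ptD addnC -/d {1}(divn_eq d M).
  by elim: (d %/ M)%N => // q IH; rewrite mulSn -addnA addnC pM.
transitivity #|[set A in orbits | (pt 0 \in A) && (pt (d %% M) \in A)]|.
  congr #|pred_of_set _|; apply/setP => A; rewrite inE; apply/imsetP/andP.
    case=> B; rewrite !inE => /and3P[Bf iB jB] ->.
    by rewrite orbits_shift -p0 -pd !mem_shift iB.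
  case=> Af /andP[A0 Ad]; exists (shift i A); last first.
    by rewrite /f shiftD subnK ?(ltnW lti) // shift_period.
  rewrite !inE orbits_shift Af -(mem_shift (M - i) (pt i)) -(mem_shift (M - i) (pt j)).
  by rewrite p0 pd shiftD subnK ?(ltnW lti) // shift_period A0.
rewrite (orbits_through (fun A => pt (d %% M) \in A)).
apply: eq_in_count => c cC /=; rewrite -{1}(Nat2N.id (d %% M)) mem_block //.
  exact: (allP okC).
by have := ltn_pmod d period_gt0; lia.
Qed.
End Family.
End Cyclic.

(** * Checking the families by computation *)

Inductive tree := Leaf | Node of tree & N & tree.
(** The tree is a binary trie: the path to an entry spells the digits of its index, and absent
    entries read as 0. *)
Fixpoint get (i : positive) t : N :=
  match t, i with
  | Leaf, _ => 0%num
  | Node _ v _, xH => v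
  | Node l _ _, xO j => get j l
  | Node _ _ r, xI j => get j r
  end.
Fixpoint update (f : N -> N) (i : positive) t : tree :=
  match t, i with
  | Leaf, xH => Node Leaf (f 0%num) Leaf
  | Leaf, xO j => Node (update f j Leaf) 0%num Leaf
  | Leaf, xI j => Node Leaf 0%num (update f j Leaf)
  | Node l v r, xH => Node l (f v) r
  | Node l v r, xO j => Node (update f j l) v r
  | Node l v r, xI j => Node l v (update f j r)
  end.

Lemma get_update f i j t :
  get j (update f i t) = if Pos.eqb j i then f (get i t) else get j t.
Proof.
have get_leaf k : get k Leaf = 0%num by case: k.
by elim: i j t => [i IH|i IH|] [j|j|] [|l v r] //=; rewrite ?IH ?get_leaf //; case: ifP.
Qed.

(** Indices are shifted by one to turn 0 into a [positive]. *)
Definition lookup t (i : N) := get (N.succ_pos i) t.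
Definition modify f t (i : N) := update f (N.succ_pos i) t.

Lemma lookup_modify f t i j :
  lookup (modify f t i) j = if j == i then f (lookup t i) else lookup t j.
Proof.
rewrite /lookup /modify get_update; case: Pos.eqb_spec => [/(congr1 Npos)|neq].
  by rewrite !N.succ_pos_spec => /N.succ_inj ->; rewrite eqxx.
by case: eqP neq => // ->.
Qed.

Definition fill (kv : seq (N * N)) := foldl (fun t p => modify (fun _ => p.2) t p.1) Leaf kv.

Definition histogram (C : seq (seq N)) := foldl (foldl (modify N.succ)) Leaf C.

(** In a list without duplicates the multiplicity of [l] is 1 or 0, so the increments at [l] count
    the lists containing it. *)
Lemma lookup_histogram C l : all uniq C ->
  lookup (histogram C) l = N.of_nat (count (fun c => l \in c) C).
Proof.
have inner c t : lookup (foldl (modify N.succ) t c) l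
    = (lookup t l + N.of_nat (count_mem l c))%num.
  elim: c t => [|a c IH] t /=; first by rewrite N.add_0_r.
  rewrite IH lookup_modify (eq_sym a l); case: eqVneq => [->|_]; last by rewrite add0n.
  by rewrite add1n Nat2N.inj_succ N.add_succ_l N.add_succ_r.
have outer t : all uniq C -> lookup (foldl (foldl (modify N.succ)) t C) l
    = (lookup t l + N.of_nat (count (fun c => l \in c) C))%num.
  elim: C t => [|c C IH] t /=; first by rewrite N.add_0_r.
  by case/andP => uc uC; rewrite IH // inner count_uniq_mem // Nat2N.inj_add N.add_assoc.
by move=> uC; rewrite /histogram outer // /lookup; case: N.succ_pos.
Qed.

(** Allows [perm_big] to rearrange the sum in a key. *)
HB.instance Definition _ := Monoid.isComLaw.Build N 0%num N.add N.add_assoc N.add_comm N.add_0_l.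

(* An invariant of the set of exponents of a block: distinct keys certify distinct blocks. *)
Definition key (weights : tree) (c : seq N) : N :=
  foldr (fun l a => (lookup weights l + a)%num) 0%num c.

Lemma key_perm w c c' : perm_eq c c' -> key w c = key w c'.
Proof.
have keyE s : key w s = \big[N.add/0%num]_(l <- s) lookup w l.
  by elim: s => [|l s IH]; rewrite ?big_nil ?big_cons //= IH.
by move=> cc'; rewrite !keyE; apply: perm_big.
Qed.

(** * Executable checks for families given by bases *)

Section Check.
Variables (m : nat) (poly period : N).
Notation n := m.+1.
Notation W := 'rV['F_2]_n.
Notation M := (N.to_nat period).

Definition powers := traject (step m poly) 1%num M.
Definition exponents := map N.of_nat (iota 0 M).
Definition exp_table := fill (zip exponents powers).
Definition log_table := fill (zip powers exponents).
(* Any weights without collisions of keys would do. *)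
Definition weights :=
  fill [seq (i, (i * i * i * i * 10007) mod 4294967296)%num | i <- exponents].

Definition code_ok (a : N) := ((0 <? a) && (a <? 2 ^ N.of_nat n))%num.

(** The table is compared with the list of powers entry by entry, which replaces any reasoning about
    [fill]. *)
Definition log_table_ok :=
  let t := log_table in let s := powers in
  all (fun a => let l := lookup t a in (l <? period)%num && (nth 1%num s (N.to_nat l) == a))
    (map N.of_nat (iota 1 M)).

(** Linear independence, tested by listing the sums of nonempty sublists. *)
Definition basis_ok k (b : seq N) :=
  let s := behead (xor_span b) in [&& size b == k, all code_ok s & uniq s].

Definition logs t (b : seq N) := map (lookup t) (behead (xor_span b)).

(* Blocks that are spaces over a subfield: dividing them by any of their vectors fixes them.
   The preliminary test is for speed only: [all] does not stop early under [vm_compute]. *)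
Definition stable (s : seq N) :=
  let fixed_by u := all (mem s) (map (derot period u) s) in
  if fixed_by (last 0%num s) then all fixed_by s else false.

(** A stable block equals all its quotients; listing it once per vector would make its keys
    collide. *)
Definition through_one (s : seq N) :=
  if stable s then [:: s] else derots period s.

Definition through_ones (S : seq (seq N)) := flatten (map through_one S).

Definition part t (bs : seq (seq N)) := map (logs t) bs.

Definition point_counts (P : seq (seq (seq N))) : seq nat :=
  let t := log_table in [seq size (through_ones (part t bs)) | bs <- P].

(** [behead exponents] omits the exponent 0 of the vector 1, which lies in all listed blocks.
    Distinctness of the keys of all parts together is tested by sorting, to avoid a quadratic number
    of comparisons. *)
Definition parts_ok k (P : seq (seq (seq N))) (X : seq nat) : bool :=
  let t := log_table in
  let w := weights in
  let Cs := [seq through_ones (part t bs) | bs <- P] in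
  let X' := map N.of_nat X in
  let ls := behead exponents in
  [&& all (all (basis_ok k)) P,
      all2 (fun C x => let h := histogram C in all (fun l => lookup h l == x) ls) Cs X'
    & sorted N.ltb (sort N.leb (flatten [seq map (key w) C | C <- Cs]))].

(** * Soundness of the checks *)

Hypothesis prim : primitive m poly period.
Hypothesis tab : log_table_ok.
Variable k : nat.
Hypothesis k_gt0 : (0 < k)%N.
Notation pt := (pt m poly).
Notation block := (block m poly).

Lemma logP a : code_ok a -> (lookup log_table a < period)%num /\
   pt (N.to_nat (lookup log_table a)) = dec n a.
Proof.
case/andP => /N.ltb_lt a0 /N.ltb_lt an.
have a_in : a \in map N.of_nat (iota 1 M).
  apply/mapP; exists (N.to_nat a); last by rewrite N2Nat.id.
  rewrite mem_iota; case/and4P: prim => /eqP -> _ _ _; lia.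
have /andP[/N.ltb_lt lt_l /eqP nth_l] := allP tab a a_in.
split; first exact: lt_l.
rewrite pt_dec -[X in _ = dec _ X]nth_l nth_traject; [by [] | lia].
Qed.

Lemma basis_okP b : basis_ok k b ->
  [/\ size b = k, {in behead (xor_span b), forall a, code_ok a} & uniq (behead (xor_span b))].
Proof. by case/and3P => /eqP ? /allP ? ?. Qed.

Lemma logs_logs_ok b : basis_ok k b -> logs_ok period (logs log_table b).
Proof.
case/basis_okP => _ ok ub; apply/andP; split; last first.
  by apply/allP => _ /mapP[a /ok/logP[/N.ltb_lt lt_l _] ->].
rewrite map_inj_in_uniq // => a a' /ok oka /ok oka' eql.
have [_ eqa] := logP oka; have [_ eqa'] := logP oka'.
case/andP: oka => _ /N.ltb_lt lta; case/andP: oka' => _ /N.ltb_lt lta'.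
by apply: (dec_inj lta lta'); rewrite -eqa -eqa' eql.
Qed.

Lemma block_logs b : basis_ok k b ->
  block (logs log_table b) = [set:: map (dec n) (xor_span b)].
Proof.
case/basis_okP => _ ok _; rewrite /block xor_span_behead map_cons dec0.
suff -> : [seq pt (N.to_nat l) | l <- logs log_table b] = map (dec n) (behead (xor_span b)) by [].
by rewrite -map_comp; apply/eq_in_map => a /ok/logP[].
Qed.

Lemma block_logs_sub b : basis_ok k b ->
  let A := block (logs log_table b) in
  [/\ 0 \in A, {in A &, forall x y, x + y \in A} & #|A| = (2 ^ k)%N].
Proof.
move=> okb A; rewrite {}/A; have [szb _ _] := basis_okP okb.
split; first by rewrite inE in_cons eqxx.
  rewrite block_logs // => x y; rewrite !inE => /mapP[a a_in ->] /mapP[b' b_in ->].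
  by rewrite -dec_lxor map_f // xor_span_lxor.
by rewrite (card_block prim (logs_logs_ok okb)) size_map size_behead size_xor_span szb
  prednK ?expn_gt0.
Qed.

Section Part.
Variables (bs : seq (seq N)).
Hypothesis okbs : all (basis_ok k) bs.
Let S := part log_table bs.
Let C := through_ones S.

Lemma part_logs_ok : all (logs_ok period) S.
Proof. by apply/allP => _ /mapP[b /(allP okbs) okb ->]; apply: logs_logs_ok. Qed.

(** [stable] only tests that the quotient is contained in the block; both have the same size, so
    they are equal. *)
Lemma stableP s u : logs_ok period s -> u \in s -> stable s ->
  block s = block (map (derot period u) s).
Proof.
move=> oks us; rewrite /stable; case: ifP => // _ /allP/(_ u us)/allP sub_s.
have ltu : (u < period)%num by case/andP: oks => _ /allP/(_ u us)/N.ltb_lt.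
have eqs : map (derot period u) s =i s.
  have /andP[ud _] := derot_ok prim ltu oks.
  by case: (uniq_min_size ud (s2 := s)) => [l /sub_s||]; rewrite ?size_map.
apply/setP => v; rewrite !inE; congr orb.
by apply/mapP/mapP => -[l ls ->]; exists l; rewrite // ?eqs // -eqs.
Qed.

(** Since [k > 0] the list is nonempty, and [last] does not return its default. *)
Lemma last_logs s : s \in S -> last 0%num s \in s.
Proof.
case/mapP => b /(allP okbs)/basis_okP[szb _ _] ->.
have : (0 < size (logs log_table b))%N.
  rewrite size_map size_behead size_xor_span szb -subn1 subn_gt0.
  by rewrite -{1}(expn0 2) ltn_exp2l.
by case: (logs _ _) => // a l _; exact: (mem_last a l).
Qed.

Lemma through_ones_ok : all (logs_ok period) C.
Proof.
apply/allP => c /flattenP[_ /mapP[s sS ->]]; have oks := allP part_logs_ok s sS.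
rewrite /through_one; case: ifP => [_|_]; first by rewrite inE => /eqP->.
case/mapP => u us ->; apply: (derot_ok prim) => //.
by case/andP: oks => _ /allP/(_ u us)/N.ltb_lt.
Qed.

Lemma through_ones_sound c : c \in C ->
  exists2 s, s \in S & exists2 u, u \in s & block c = block (map (derot period u) s).
Proof.
case/flattenP=> _ /mapP[s sS ->]; have oks := allP part_logs_ok s sS.
rewrite /through_one; case: ifP => [st|_].
  rewrite inE => /eqP->; exists s => //; exists (last 0%num s); first exact: last_logs.
  by apply: stableP => //; apply: last_logs.
by case/mapP => u us ->; exists s => //; exists u.
Qed.

Lemma through_ones_complete s u : s \in S -> u \in s ->
  exists2 c, c \in C & block c = block (map (derot period u) s).
Proof.
move=> sS us; have oks := allP part_logs_ok s sS; case: (boolP (stable s)) => st.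
  exists s; last exact: stableP.
  by apply/flattenP; exists (through_one s); rewrite ?map_f // /through_one st inE.
exists (map (derot period u) s) => //; apply/flattenP.
exists (through_one s); rewrite ?map_f // /through_one (negbTE st).
by apply/mapP; exists u.
Qed.

(** Equal blocks have the same exponents up to order, hence the same key. *)
Lemma uniq_blocks w : uniq (map (key w) C) -> uniq (map block C).
Proof.
have key_block c c' : c \in C -> c' \in C -> block c = block c' -> key w c = key w c'.
  move=> /(allP through_ones_ok) okc /(allP through_ones_ok) okc' eqb; apply: key_perm.
  have /andP[uc /allP ltc] := okc; have /andP[uc' /allP ltc'] := okc'.
  apply: uniq_perm => // l; apply/idP/idP => lc.
    move/N.ltb_lt: (ltc l lc) => ltl.
    by rewrite -(mem_block prim okc' ltl) -eqb (mem_block prim okc ltl).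
  move/N.ltb_lt: (ltc' l lc) => ltl.
  by rewrite -(mem_block prim okc ltl) eqb (mem_block prim okc' ltl).
elim: (C) key_block => //= c D IH key_block /andP[cD uD].
rewrite IH //; last by move=> a b aD bD; apply: key_block; rewrite inE ?aD ?bD orbT.
rewrite andbT; apply: contra cD => /mapP[c' c'D eqb]; apply/mapP; exists c' => //.
by apply: key_block => //; rewrite inE ?eqxx ?c'D ?orbT.
Qed.

(** Dividing a block by its vector x^u sends that vector to 1, whose exponent is 0. *)
Lemma mem0_through_ones c : c \in C -> 0%num \in c.
Proof.
move=> cC; have := allP through_ones_ok c cC.
have [s sS [u us eqc]] := through_ones_sound cC => okc.
have p_gt0 : (0 < period)%num by have := period_gt0 prim; lia.
rewrite -(mem_block prim okc p_gt0) eqc inE in_cons; apply/orP; right.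
apply/mapP; exists 0%num => //; apply/mapP; exists u => //.
by rewrite /derot N.leb_refl N.sub_diag.
Qed.

Let fam := orbits m poly period S.

(** The cycle acts by additive bijections, so translates of subspaces are subspaces of the same
    size. *)
Lemma part_family_sub A : A \in fam ->
  [/\ 0 \in A, {in A &, forall x y, x + y \in A} & #|A| = (2 ^ k)%N].
Proof.
case/(orbitsP prim) => _ /mapP[b /(allP okbs) okb ->] [j ->].
have [b0 bD cardb] := block_logs_sub okb.
have itD i x y :
    iter i (sigma poly) (x + y) = iter i (sigma poly) x + iter i (@sigma m poly) y.
  by elim: i => //= i ->; rewrite sigmaD.
split; last by rewrite /shift card_imset //; apply: (iter_sigma_inj prim).
  apply/imsetP; exists 0 => //.
  by elim: (j) => //= i <-; rewrite sigma0.
move=> _ _ /imsetP[x xb ->] /imsetP[y yb ->]; rewrite -itD; apply: imset_f; exact: bD.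
Qed.

Variable w : tree.
Hypothesis uniq_keys : uniq (map (key w) C).

(** This is the count for the degenerate pair [(a, a)]: its exponent is 0, which occurs in every
    list of [C]. *)
Lemma part_family_point a : a != 0 -> #|[set A in fam | a \in A]| = size C.
Proof.
move=> a0.
have [l [_ [_ l0]] eqc] := orbits_count prim part_logs_ok through_ones_ok
  through_ones_sound through_ones_complete (uniq_blocks uniq_keys) a0 a0.
have -> : [set A in fam | a \in A] = [set A in fam | (a \in A) && (a \in A)].
  by apply/setP => A; rewrite !inE andbb.
rewrite eqc l0 //; apply/eqP; rewrite -all_count; apply/allP; exact: mem0_through_ones.
Qed.

(** Distinct [a] and [b] have a quotient other than 1, so only the histogram entries at nonzero
    exponents are read. *)
Lemma part_family_pair x :
  (forall l, l \in behead exponents -> lookup (histogram C) l = N.of_nat x) ->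
  forall a b, a != 0 -> b != 0 -> a != b ->
    #|[set A in fam | (a \in A) && (b \in A)]| = x.
Proof.
move=> hist a b a0 b0 a_b.
have [l [ltl [l_eq _]] ->] := orbits_count prim part_logs_ok through_ones_ok
  through_ones_sound through_ones_complete (uniq_blocks uniq_keys) a0 b0.
have uC : all uniq C by apply: sub_all through_ones_ok => c /andP[].
apply: Nat2N.inj; rewrite -lookup_histogram // hist //.
have l0 : l <> 0%num by move/l_eq/eqP; rewrite (negbTE a_b).
rewrite /exponents; have := period_gt0 prim; case E: M => [|M'] // _ /=.
by apply/mapP; exists (N.to_nat l); rewrite ?N2Nat.id // mem_iota; lia.
Qed.

End Part.

(** * Unions of checked parts *)

Lemma through_ones_flatten t (P : seq (seq (seq N))) :
  through_ones (part t (flatten P)) = flatten [seq through_ones (part t bs) | bs <- P].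
Proof.
elim: P => //= bs P IH.
by rewrite /through_ones /part !map_cat flatten_cat -IH.
Qed.

(* All keys of all the parts being distinct, any union of parts [mask ms P] is again a
   family without repeated blocks. *)
Section Parts.
Variables (P : seq (seq (seq N))) (X : seq nat) (ms : bitseq).
Hypothesis okP : parts_ok k P X.
Let bs := flatten (mask ms P).
Definition parts_family (Q : seq (seq (seq N))) (qs : bitseq) :=
  orbits m poly period (part log_table (flatten (mask qs Q))).
Let C := through_ones (part log_table bs).

Lemma parts_bases : all (basis_ok k) bs.
Proof.
case/and3P: okP => /allP ok _ _; apply/allP => b /flattenP[p /mem_mask/ok/allP okp /okp].
by [].
Qed.

(** The keys of the selected parts form a subsequence of the list of all keys. *)
Lemma parts_keys : uniq (map (key weights) C).
Proof.
case/and3P: okP => _ _ so.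
have : uniq (flatten [seq map (key weights) (through_ones (part log_table p)) | p <- P]).
  rewrite -(sort_uniq N.leb) map_comp; apply: sorted_uniq so => [a b c|a]; last first.
    exact: N.ltb_irrefl.
  by move=> /N.ltb_lt ? /N.ltb_lt ?; apply/N.ltb_lt; lia.
apply: subseq_uniq; rewrite /C /bs through_ones_flatten map_flatten -map_comp.
elim: (P) (ms) => [|p Q IH] [|[] qs] //=; rewrite ?sub0seq //.
  by rewrite cat_subseq.
exact: subseq_trans (IH qs) (suffix_subseq _ _).
Qed.

Lemma parts_family_sub A : A \in parts_family P ms ->
  [/\ 0 \in A, {in A &, forall x y, x + y \in A} & #|A| = (2 ^ k)%N].
Proof. exact: (part_family_sub parts_bases). Qed.

Lemma parts_family_point a : a != 0 ->
  #|[set A in parts_family P ms | a \in A]| = sumn (mask ms (point_counts P)).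
Proof.
move=> a0; rewrite (part_family_point parts_bases parts_keys a0).
by rewrite /bs through_ones_flatten size_flatten /shape /point_counts !map_mask
  -map_comp.
Qed.

Lemma parts_family_pair a b : a != 0 -> b != 0 -> a != b ->
  #|[set A in parts_family P ms | (a \in A) && (b \in A)]| = sumn (mask ms X).
Proof.
apply: (part_family_pair parts_bases parts_keys) => l l_in.
have uC : all uniq C by apply: sub_all (through_ones_ok parts_bases) => c /andP[].
rewrite lookup_histogram //; congr N.of_nat.
have : all (fun bs => all uniq (through_ones (part log_table bs))) P.
  apply/allP => p pP; case/and3P: okP => /allP/(_ p pP) okp _ _.
  by apply: sub_all (through_ones_ok okp) => c /andP[].
case/and3P: okP => _ h _; rewrite /bs through_ones_flatten count_flatten.
elim: (P) (X) h (ms) => [|p Q IH] [|x Y] //= => [_ [|[]]|] //.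
move=> /andP[hp hQ] [|[] qs] //= /andP[uP uQ].
  congr addn; last exact: IH.
  by apply: Nat2N.inj; rewrite -lookup_histogram //; apply/eqP/(allP hp).
exact: IH.
Qed.
End Parts.
End Check.

(** The masks [ms] and [ns] select the parts for planes and for solids; the last two premises are
    the numerical conditions of the extension, left to be closed by evaluation. *)
Lemma design_of_parts m poly period k (PD PE : seq (seq (seq N)))
    (XD XE RD : seq nat) ms ns lambda :
  primitive m poly period -> log_table_ok m poly period -> (0 < k <= m.+1)%N ->
  parts_ok m poly period k PD XD -> point_counts m poly period PD = RD ->
  parts_ok m poly period k.+1 PE XE ->
  sumn (mask ms RD) = lambda ->
  (2 ^ (m.+1 - k) * sumn (mask ms XD) + sumn (mask ns XE))%N = lambda ->
  exists (V : vectType 'F_2) (S : {fset {vspace V}}), subspace_design 2 m.+2 k.+1 lambda S.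
Proof.
move=> prim tab /andP[k0 le_k] okD szD okE eqR eqX.
rewrite -(addn1 m.+1); apply: subspace_design_of_pairs.
apply: (@extension_pair_design m.+1 k lambda
  (parts_family m poly period PD ms) (parts_family m poly period PE ns)) => //.
- exact: (parts_family_sub prim tab k0 okD).
- exact: (parts_family_sub prim tab (ltn0Sn k) okE).
- by move=> a a0; rewrite (parts_family_point prim tab k0 ms okD) // szD.
- move=> a b a0 b0 a_b.
  rewrite (parts_family_pair prim tab k0 ms okD) //.
  by rewrite (parts_family_pair prim tab (ltn0Sn k) ns okE).
Qed.

(** * The designs *)

(* Bases, to which the vector 1 is added, of representatives of the orbits; vectors are given
   by their codes modulo x^7 + x + 1 and x^9 + x^4 + 1. *)
Definition planes7 : seq (seq (seq N)) :=
  map (map (cons 1%num)) [::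
  [::
    [:: 2; 12]; [:: 6; 8]; [:: 6; 32]; [:: 10; 22]; [:: 12; 20]; [:: 12; 36]; [:: 16; 42];
    [:: 18; 40]; [:: 20; 38]; [:: 26; 34]; [:: 28; 44]; [:: 40; 66]];
  [::
    [:: 2; 48]; [:: 4; 8]; [:: 6; 24]; [:: 6; 26]; [:: 10; 16]; [:: 10; 38]; [:: 12; 18];
    [:: 16; 32]; [:: 20; 34]; [:: 26; 36]; [:: 28; 38]; [:: 28; 40]];
  [::
    [:: 2; 56]; [:: 4; 26]; [:: 4; 48]; [:: 8; 34]; [:: 14; 16]; [:: 16; 66]; [:: 18; 34];
    [:: 26; 32]; [:: 30; 32]];
  [::
    [:: 2; 8]; [:: 6; 16]; [:: 8; 20]; [:: 10; 18]; [:: 10; 32]; [:: 12; 38]; [:: 12; 66];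
    [:: 14; 18]; [:: 14; 22]; [:: 20; 44]; [:: 22; 32]; [:: 24; 40]; [:: 42; 64]; [:: 42; 66];
    [:: 44; 64]]]%num.

Definition solids7 : seq (seq (seq N)) :=
  map (map (cons 1%num)) [::
  [::
    [:: 2; 4; 24]; [:: 2; 28; 32]; [:: 4; 26; 32]; [:: 6; 8; 18]; [:: 6; 24; 32];
    [:: 10; 16; 34]; [:: 10; 16; 36]; [:: 10; 20; 32]; [:: 12; 16; 38]; [:: 14; 18; 32];
    [:: 14; 22; 32]; [:: 28; 42; 64]];
  [::
    [:: 2; 4; 32]; [:: 2; 16; 40]; [:: 2; 24; 36]; [:: 6; 8; 16]; [:: 6; 8; 34]; [:: 6; 10; 34];
    [:: 6; 26; 32]; [:: 8; 16; 32]; [:: 8; 20; 34]; [:: 12; 18; 36]; [:: 12; 22; 34];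
    [:: 14; 20; 32]];
  [::
    [:: 2; 12; 36]; [:: 4; 10; 32]; [:: 6; 8; 32]; [:: 6; 10; 16]; [:: 6; 18; 32];
    [:: 10; 48; 64]; [:: 12; 16; 36]; [:: 12; 20; 36]; [:: 14; 18; 38]];
  [::
    [:: 2; 4; 16]; [:: 2; 8; 48]; [:: 2; 12; 16]; [:: 2; 20; 32]; [:: 4; 8; 34]; [:: 4; 10; 18];
    [:: 4; 24; 40]; [:: 6; 10; 32]; [:: 6; 40; 64]; [:: 8; 20; 36]; [:: 8; 34; 64];
    [:: 10; 22; 32]; [:: 14; 22; 38]; [:: 20; 32; 64]; [:: 26; 32; 64]]]%num.

(** A separate family for x = 14, which is no sum of the values 4, 4, 3, 5 of the parts in
    [planes7]. *)
Definition planes7_14 : seq (seq (seq N)) :=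
  map (map (cons 1%num)) [::
  [::
    [:: 2; 4]; [:: 2; 28]; [:: 2; 32]; [:: 4; 8]; [:: 4; 10]; [:: 4; 18]; [:: 4; 26];
    [:: 4; 48]; [:: 6; 16]; [:: 6; 18]; [:: 6; 24]; [:: 6; 32]; [:: 6; 34]; [:: 6; 40];
    [:: 8; 22]; [:: 8; 34]; [:: 8; 70]; [:: 10; 18]; [:: 10; 38]; [:: 12; 20]; [:: 12; 22];
    [:: 14; 18]; [:: 14; 20]; [:: 14; 38]; [:: 16; 32]; [:: 16; 36]; [:: 16; 40]; [:: 16; 42];
    [:: 18; 32]; [:: 18; 40]; [:: 20; 32]; [:: 20; 44]; [:: 22; 32]; [:: 26; 34]; [:: 28; 32];
    [:: 28; 38]; [:: 28; 44]; [:: 30; 66]; [:: 40; 66]; [:: 44; 64]; [:: 44; 66]; [:: 52; 64]]]%num.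

(** The companion of [planes7_14], with y = 5 * 14. *)
Definition solids7_70 : seq (seq (seq N)) :=
  map (map (cons 1%num)) [::
  [::
    [:: 2; 4; 8]; [:: 2; 4; 32]; [:: 2; 8; 48]; [:: 2; 12; 16]; [:: 2; 12; 20]; [:: 2; 12; 36];
    [:: 2; 20; 36]; [:: 2; 28; 32]; [:: 2; 28; 40]; [:: 4; 8; 16]; [:: 4; 10; 16];
    [:: 4; 10; 32]; [:: 4; 18; 32]; [:: 4; 18; 34]; [:: 4; 24; 40]; [:: 6; 8; 32];
    [:: 6; 10; 34]; [:: 6; 18; 34]; [:: 6; 24; 32]; [:: 6; 24; 34]; [:: 6; 26; 32];
    [:: 6; 26; 34]; [:: 8; 16; 32]; [:: 8; 18; 32]; [:: 8; 20; 32]; [:: 8; 20; 36];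
    [:: 10; 16; 32]; [:: 10; 16; 34]; [:: 10; 16; 36]; [:: 10; 22; 32]; [:: 12; 16; 38];
    [:: 12; 20; 32]; [:: 12; 22; 32]; [:: 12; 22; 34]; [:: 12; 36; 64]; [:: 14; 16; 38];
    [:: 14; 22; 32]; [:: 14; 54; 64]; [:: 26; 32; 64]; [:: 28; 40; 64]; [:: 28; 42; 64];
    [:: 30; 44; 64]]]%num.

Definition planes9 : seq (seq (seq N)) :=
  map (map (cons 1%num)) [::
  [::
    [:: 2; 16]; [:: 2; 36]; [:: 2; 128]; [:: 2; 152]; [:: 2; 188]; [:: 2; 240]; [:: 4; 26];
    [:: 4; 48]; [:: 4; 64]; [:: 4; 96]; [:: 4; 98]; [:: 4; 130]; [:: 4; 170]; [:: 4; 194];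
    [:: 6; 8]; [:: 6; 48]; [:: 6; 72]; [:: 6; 96]; [:: 6; 104]; [:: 6; 114]; [:: 6; 146];
    [:: 6; 186]; [:: 8; 38]; [:: 8; 48]; [:: 8; 64]; [:: 8; 82]; [:: 8; 84]; [:: 10; 22];
    [:: 10; 48]; [:: 10; 82]; [:: 10; 84]; [:: 10; 96]; [:: 10; 134]; [:: 10; 148];
    [:: 10; 224]; [:: 10; 228]; [:: 12; 16]; [:: 12; 48]; [:: 12; 70]; [:: 12; 100];
    [:: 12; 118]; [:: 12; 134]; [:: 12; 278]; [:: 12; 292]; [:: 12; 294]; [:: 14; 22];
    [:: 14; 38]; [:: 14; 102]; [:: 14; 116]; [:: 14; 176]; [:: 16; 42]; [:: 16; 76];
    [:: 16; 170]; [:: 16; 202]; [:: 18; 32]; [:: 18; 38]; [:: 18; 40]; [:: 18; 110];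
    [:: 18; 160]; [:: 18; 172]; [:: 20; 40]; [:: 20; 76]; [:: 20; 78]; [:: 20; 110];
    [:: 22; 32]; [:: 22; 34]; [:: 22; 44]; [:: 22; 46]; [:: 22; 134]; [:: 22; 140];
    [:: 22; 200]; [:: 22; 260]; [:: 24; 64]; [:: 24; 106]; [:: 24; 172]; [:: 26; 72];
    [:: 26; 76]; [:: 26; 142]; [:: 28; 36]; [:: 28; 66]; [:: 28; 68]; [:: 28; 78]; [:: 28; 98];
    [:: 28; 108]; [:: 28; 110]; [:: 28; 130]; [:: 28; 140]; [:: 28; 332]; [:: 30; 42];
    [:: 30; 100]; [:: 32; 68]; [:: 32; 82]; [:: 32; 94]; [:: 32; 158]; [:: 32; 222];
    [:: 34; 76]; [:: 34; 130]; [:: 34; 142]; [:: 34; 150]; [:: 34; 152]; [:: 34; 214];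
    [:: 36; 68]; [:: 36; 70]; [:: 36; 92]; [:: 36; 128]; [:: 36; 136]; [:: 36; 262];
    [:: 38; 94]; [:: 38; 134]; [:: 38; 150]; [:: 40; 72]; [:: 40; 138]; [:: 40; 156];
    [:: 40; 216]; [:: 42; 68]; [:: 42; 138]; [:: 44; 72]; [:: 44; 82]; [:: 44; 92];
    [:: 44; 154]; [:: 44; 202]; [:: 46; 70]; [:: 46; 94]; [:: 46; 128]; [:: 46; 134];
    [:: 46; 140]; [:: 46; 148]; [:: 48; 64]; [:: 48; 66]; [:: 48; 72]; [:: 48; 76];
    [:: 48; 154]; [:: 48; 216]; [:: 50; 66]; [:: 50; 84]; [:: 50; 132]; [:: 50; 146];
    [:: 50; 158]; [:: 52; 64]; [:: 52; 70]; [:: 52; 76]; [:: 52; 82]; [:: 52; 88]; [:: 52; 136];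
    [:: 52; 266]; [:: 52; 286]; [:: 54; 64]; [:: 54; 70]; [:: 54; 84]; [:: 54; 86];
    [:: 54; 134]; [:: 54; 136]; [:: 54; 148]; [:: 54; 258]; [:: 56; 66]; [:: 56; 86];
    [:: 56; 148]; [:: 58; 76]; [:: 58; 154]; [:: 60; 72]; [:: 60; 148]; [:: 60; 206];
    [:: 60; 260]; [:: 62; 72]; [:: 62; 86]; [:: 62; 140]; [:: 62; 214]; [:: 64; 158];
    [:: 66; 178]; [:: 70; 138]; [:: 72; 172]; [:: 72; 178]; [:: 74; 154]; [:: 74; 162];
    [:: 74; 170]; [:: 74; 180]; [:: 76; 146]; [:: 76; 158]; [:: 76; 174]; [:: 78; 166];
    [:: 78; 268]; [:: 78; 270]; [:: 80; 154]; [:: 80; 258]; [:: 80; 302]; [:: 82; 152];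
    [:: 82; 180]; [:: 82; 290]; [:: 84; 134]; [:: 84; 136]; [:: 84; 272]; [:: 84; 276];
    [:: 86; 144]; [:: 86; 146]; [:: 86; 174]; [:: 86; 180]; [:: 86; 190]; [:: 88; 152];
    [:: 88; 266]; [:: 90; 132]; [:: 90; 138]; [:: 90; 188]; [:: 92; 162]; [:: 92; 170];
    [:: 92; 256]; [:: 92; 280]; [:: 92; 284]; [:: 94; 128]; [:: 96; 132]; [:: 96; 158];
    [:: 96; 164]; [:: 98; 276]; [:: 100; 140]; [:: 100; 190]; [:: 102; 150]; [:: 102; 170];
    [:: 102; 174]; [:: 104; 138]; [:: 104; 142]; [:: 104; 152]; [:: 106; 132]; [:: 106; 150];
    [:: 106; 156]; [:: 106; 170]; [:: 108; 130]; [:: 108; 148]; [:: 108; 272]; [:: 110; 258];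
    [:: 112; 144]; [:: 114; 180]; [:: 116; 132]; [:: 116; 134]; [:: 116; 146]; [:: 116; 166];
    [:: 118; 146]; [:: 118; 158]; [:: 118; 190]; [:: 120; 128]; [:: 120; 130]; [:: 120; 132];
    [:: 120; 136]; [:: 120; 164]; [:: 122; 128]; [:: 122; 144]; [:: 122; 148]; [:: 126; 142];
    [:: 126; 152]; [:: 126; 158]; [:: 126; 166]; [:: 126; 288]; [:: 136; 260]; [:: 144; 282];
    [:: 146; 260]; [:: 160; 282]; [:: 164; 296]; [:: 176; 264]; [:: 176; 276]; [:: 180; 288];
    [:: 182; 256]; [:: 184; 274]; [:: 184; 284]; [:: 190; 264]; [:: 192; 266]; [:: 212; 290];
    [:: 218; 286]; [:: 228; 272]; [:: 240; 276]; [:: 242; 274]];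
  [::
    [:: 2; 44]; [:: 2; 56]; [:: 2; 68]; [:: 2; 104]; [:: 2; 112]; [:: 2; 148]; [:: 2; 232];
    [:: 4; 18]; [:: 4; 24]; [:: 4; 32]; [:: 4; 40]; [:: 4; 50]; [:: 4; 58]; [:: 4; 90];
    [:: 4; 226]; [:: 6; 32]; [:: 6; 50]; [:: 6; 74]; [:: 6; 106]; [:: 6; 120]; [:: 6; 162];
    [:: 6; 202]; [:: 6; 216]; [:: 8; 34]; [:: 8; 54]; [:: 8; 134]; [:: 10; 68]; [:: 10; 100];
    [:: 10; 146]; [:: 10; 244]; [:: 12; 20]; [:: 12; 38]; [:: 12; 80]; [:: 12; 98];
    [:: 12; 116]; [:: 12; 128]; [:: 14; 48]; [:: 14; 68]; [:: 14; 82]; [:: 14; 128];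
    [:: 14; 144]; [:: 14; 150]; [:: 16; 66]; [:: 16; 134]; [:: 16; 138]; [:: 16; 174];
    [:: 18; 36]; [:: 18; 44]; [:: 18; 72]; [:: 18; 96]; [:: 18; 102]; [:: 18; 128];
    [:: 18; 138]; [:: 20; 32]; [:: 20; 36]; [:: 20; 38]; [:: 20; 42]; [:: 20; 64]; [:: 20; 74];
    [:: 20; 98]; [:: 20; 104]; [:: 20; 134]; [:: 20; 140]; [:: 22; 66]; [:: 22; 74];
    [:: 22; 162]; [:: 22; 168]; [:: 22; 202]; [:: 22; 230]; [:: 24; 38]; [:: 24; 66];
    [:: 24; 102]; [:: 24; 104]; [:: 24; 110]; [:: 24; 196]; [:: 26; 34]; [:: 26; 40];
    [:: 26; 104]; [:: 26; 134]; [:: 26; 140]; [:: 26; 256]; [:: 28; 42]; [:: 28; 72];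
    [:: 28; 74]; [:: 28; 134]; [:: 28; 160]; [:: 28; 202]; [:: 28; 206]; [:: 30; 36];
    [:: 30; 44]; [:: 30; 64]; [:: 30; 74]; [:: 30; 78]; [:: 30; 128]; [:: 32; 76]; [:: 32; 90];
    [:: 32; 142]; [:: 32; 218]; [:: 32; 276]; [:: 34; 64]; [:: 34; 68]; [:: 34; 80];
    [:: 34; 144]; [:: 34; 146]; [:: 36; 76]; [:: 36; 80]; [:: 38; 66]; [:: 38; 68]; [:: 38; 76];
    [:: 38; 84]; [:: 38; 148]; [:: 38; 158]; [:: 40; 64]; [:: 40; 76]; [:: 40; 94];
    [:: 40; 206]; [:: 42; 64]; [:: 42; 88]; [:: 42; 158]; [:: 42; 220]; [:: 44; 68];
    [:: 44; 74]; [:: 44; 76]; [:: 44; 144]; [:: 44; 146]; [:: 44; 210]; [:: 46; 130];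
    [:: 46; 138]; [:: 46; 204]; [:: 46; 256]; [:: 48; 90]; [:: 48; 128]; [:: 50; 68];
    [:: 50; 134]; [:: 50; 284]; [:: 52; 66]; [:: 54; 78]; [:: 54; 90]; [:: 54; 222];
    [:: 56; 68]; [:: 56; 146]; [:: 56; 260]; [:: 58; 82]; [:: 58; 130]; [:: 58; 132];
    [:: 58; 136]; [:: 58; 156]; [:: 58; 202]; [:: 58; 260]; [:: 60; 78]; [:: 60; 130];
    [:: 60; 132]; [:: 60; 256]; [:: 62; 92]; [:: 62; 158]; [:: 64; 154]; [:: 64; 168];
    [:: 64; 188]; [:: 68; 144]; [:: 68; 156]; [:: 68; 158]; [:: 68; 176]; [:: 70; 130];
    [:: 70; 190]; [:: 72; 136]; [:: 72; 156]; [:: 72; 176]; [:: 74; 130]; [:: 74; 150];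
    [:: 76; 130]; [:: 76; 134]; [:: 76; 180]; [:: 78; 160]; [:: 80; 128]; [:: 80; 178];
    [:: 80; 260]; [:: 80; 272]; [:: 82; 308]; [:: 84; 140]; [:: 84; 160]; [:: 84; 180];
    [:: 84; 268]; [:: 86; 128]; [:: 86; 142]; [:: 86; 258]; [:: 86; 302]; [:: 88; 138];
    [:: 90; 130]; [:: 92; 134]; [:: 92; 140]; [:: 92; 164]; [:: 94; 136]; [:: 94; 140];
    [:: 94; 162]; [:: 94; 180]; [:: 94; 256]; [:: 94; 280]; [:: 96; 130]; [:: 98; 138];
    [:: 98; 168]; [:: 100; 134]; [:: 100; 176]; [:: 102; 130]; [:: 102; 142]; [:: 102; 148];
    [:: 102; 292]; [:: 104; 146]; [:: 104; 176]; [:: 104; 186]; [:: 106; 130]; [:: 106; 158];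
    [:: 106; 160]; [:: 106; 184]; [:: 106; 190]; [:: 106; 276]; [:: 108; 128]; [:: 108; 132];
    [:: 108; 186]; [:: 110; 148]; [:: 110; 150]; [:: 110; 270]; [:: 112; 134]; [:: 112; 142];
    [:: 112; 154]; [:: 112; 188]; [:: 112; 268]; [:: 114; 162]; [:: 116; 128]; [:: 116; 152];
    [:: 116; 266]; [:: 120; 160]; [:: 122; 266]; [:: 124; 164]; [:: 126; 132]; [:: 126; 136];
    [:: 126; 160]; [:: 128; 276]; [:: 146; 296]; [:: 160; 260]; [:: 162; 256]; [:: 166; 300];
    [:: 172; 262]; [:: 172; 302]; [:: 180; 272]; [:: 198; 276]; [:: 202; 264]; [:: 204; 272];
    [:: 208; 290]; [:: 210; 278]; [:: 216; 272]; [:: 230; 264]; [:: 232; 264]; [:: 238; 264];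
    [:: 244; 256]; [:: 246; 264]]]%num.

(** A separate family for x = 42, as the parts of [planes9] only give 21, 22 and 43. *)
Definition planes9_42 : seq (seq N) :=
  map (cons 1%num) [::
    [:: 2; 4]; [:: 2; 12]; [:: 2; 16]; [:: 2; 52]; [:: 2; 68]; [:: 2; 80]; [:: 2; 100];
    [:: 2; 128]; [:: 2; 172]; [:: 2; 220]; [:: 2; 232]; [:: 2; 240]; [:: 4; 18]; [:: 4; 24];
    [:: 4; 26]; [:: 4; 32]; [:: 4; 34]; [:: 4; 42]; [:: 4; 50]; [:: 4; 64]; [:: 4; 88];
    [:: 4; 96]; [:: 4; 98]; [:: 4; 104]; [:: 4; 112]; [:: 4; 162]; [:: 4; 194]; [:: 4; 210];
    [:: 6; 8]; [:: 6; 24]; [:: 6; 50]; [:: 6; 58]; [:: 6; 64]; [:: 6; 82]; [:: 6; 98];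
    [:: 6; 114]; [:: 6; 120]; [:: 6; 136]; [:: 6; 152]; [:: 6; 170]; [:: 6; 202]; [:: 6; 208];
    [:: 6; 210]; [:: 8; 22]; [:: 8; 36]; [:: 8; 70]; [:: 8; 86]; [:: 8; 118]; [:: 8; 130];
    [:: 8; 148]; [:: 8; 164]; [:: 10; 16]; [:: 10; 18]; [:: 10; 36]; [:: 10; 48]; [:: 10; 52];
    [:: 10; 64]; [:: 10; 80]; [:: 10; 86]; [:: 10; 100]; [:: 10; 112]; [:: 10; 130];
    [:: 10; 192]; [:: 10; 196]; [:: 10; 212]; [:: 10; 224]; [:: 10; 260]; [:: 10; 308];
    [:: 12; 54]; [:: 12; 66]; [:: 12; 80]; [:: 12; 82]; [:: 12; 84]; [:: 12; 98]; [:: 12; 116];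
    [:: 12; 128]; [:: 14; 18]; [:: 14; 22]; [:: 14; 32]; [:: 14; 34]; [:: 14; 48]; [:: 14; 50];
    [:: 14; 68]; [:: 14; 70]; [:: 14; 82]; [:: 14; 112]; [:: 14; 162]; [:: 14; 176];
    [:: 16; 38]; [:: 16; 42]; [:: 16; 44]; [:: 16; 66]; [:: 16; 70]; [:: 16; 76]; [:: 16; 104];
    [:: 16; 138]; [:: 16; 170]; [:: 16; 202]; [:: 18; 34]; [:: 18; 38]; [:: 18; 42];
    [:: 18; 64]; [:: 18; 76]; [:: 18; 96]; [:: 18; 102]; [:: 18; 104]; [:: 18; 164];
    [:: 18; 166]; [:: 18; 202]; [:: 18; 322]; [:: 20; 36]; [:: 20; 42]; [:: 20; 78];
    [:: 20; 108]; [:: 20; 110]; [:: 20; 128]; [:: 20; 134]; [:: 20; 174]; [:: 22; 34];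
    [:: 22; 36]; [:: 22; 42]; [:: 22; 64]; [:: 22; 74]; [:: 22; 76]; [:: 22; 106]; [:: 22; 128];
    [:: 22; 134]; [:: 22; 136]; [:: 22; 140]; [:: 22; 164]; [:: 22; 230]; [:: 22; 260];
    [:: 24; 46]; [:: 24; 66]; [:: 24; 70]; [:: 24; 106]; [:: 24; 196]; [:: 24; 204];
    [:: 24; 230]; [:: 24; 256]; [:: 26; 32]; [:: 26; 34]; [:: 26; 44]; [:: 26; 68]; [:: 26; 70];
    [:: 26; 74]; [:: 26; 106]; [:: 26; 110]; [:: 26; 140]; [:: 26; 164]; [:: 26; 174];
    [:: 26; 196]; [:: 28; 46]; [:: 28; 76]; [:: 28; 96]; [:: 28; 100]; [:: 28; 130];
    [:: 28; 142]; [:: 28; 160]; [:: 28; 162]; [:: 28; 172]; [:: 28; 202]; [:: 28; 256];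
    [:: 28; 296]; [:: 30; 32]; [:: 30; 34]; [:: 30; 40]; [:: 30; 46]; [:: 30; 64]; [:: 30; 72];
    [:: 30; 74]; [:: 30; 102]; [:: 30; 108]; [:: 30; 142]; [:: 32; 88]; [:: 32; 94];
    [:: 32; 276]; [:: 34; 68]; [:: 34; 70]; [:: 34; 72]; [:: 34; 82]; [:: 34; 86]; [:: 34; 142];
    [:: 34; 150]; [:: 34; 152]; [:: 34; 202]; [:: 36; 64]; [:: 36; 66]; [:: 36; 70];
    [:: 36; 74]; [:: 36; 78]; [:: 36; 90]; [:: 36; 94]; [:: 36; 130]; [:: 36; 262]; [:: 38; 68];
    [:: 38; 74]; [:: 38; 82]; [:: 38; 94]; [:: 38; 128]; [:: 38; 130]; [:: 38; 148];
    [:: 38; 192]; [:: 38; 274]; [:: 40; 66]; [:: 40; 72]; [:: 40; 84]; [:: 40; 88]; [:: 40; 90];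
    [:: 40; 92]; [:: 40; 94]; [:: 40; 138]; [:: 40; 144]; [:: 40; 156]; [:: 40; 206];
    [:: 40; 216]; [:: 42; 66]; [:: 42; 78]; [:: 42; 88]; [:: 42; 90]; [:: 42; 132];
    [:: 42; 146]; [:: 44; 66]; [:: 44; 68]; [:: 44; 72]; [:: 44; 76]; [:: 44; 132];
    [:: 44; 146]; [:: 44; 148]; [:: 44; 202]; [:: 44; 222]; [:: 46; 66]; [:: 46; 70];
    [:: 46; 82]; [:: 46; 84]; [:: 46; 92]; [:: 46; 94]; [:: 46; 128]; [:: 46; 144];
    [:: 46; 148]; [:: 48; 64]; [:: 48; 66]; [:: 48; 76]; [:: 48; 78]; [:: 48; 90]; [:: 48; 132];
    [:: 48; 142]; [:: 50; 64]; [:: 50; 66]; [:: 50; 78]; [:: 50; 82]; [:: 50; 130];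
    [:: 50; 136]; [:: 50; 284]; [:: 52; 68]; [:: 52; 76]; [:: 52; 94]; [:: 52; 132];
    [:: 52; 134]; [:: 52; 148]; [:: 52; 154]; [:: 52; 266]; [:: 54; 64]; [:: 54; 68];
    [:: 54; 72]; [:: 54; 76]; [:: 54; 82]; [:: 54; 84]; [:: 54; 86]; [:: 54; 92]; [:: 54; 128];
    [:: 54; 134]; [:: 54; 140]; [:: 54; 258]; [:: 56; 66]; [:: 56; 70]; [:: 56; 80];
    [:: 56; 90]; [:: 56; 136]; [:: 56; 146]; [:: 56; 202]; [:: 56; 260]; [:: 58; 64];
    [:: 58; 68]; [:: 58; 70]; [:: 58; 76]; [:: 58; 80]; [:: 58; 84]; [:: 58; 94]; [:: 58; 132];
    [:: 58; 136]; [:: 58; 148]; [:: 58; 150]; [:: 58; 154]; [:: 58; 158]; [:: 60; 68];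
    [:: 60; 74]; [:: 60; 78]; [:: 60; 146]; [:: 60; 206]; [:: 60; 256]; [:: 60; 260];
    [:: 62; 72]; [:: 62; 78]; [:: 62; 80]; [:: 62; 82]; [:: 62; 88]; [:: 62; 144]; [:: 62; 146];
    [:: 62; 148]; [:: 62; 214]; [:: 62; 222]; [:: 62; 274]; [:: 62; 284]; [:: 64; 130];
    [:: 64; 138]; [:: 64; 158]; [:: 64; 180]; [:: 64; 188]; [:: 66; 160]; [:: 66; 178];
    [:: 68; 146]; [:: 68; 158]; [:: 70; 146]; [:: 70; 182]; [:: 72; 130]; [:: 72; 136];
    [:: 72; 140]; [:: 72; 144]; [:: 72; 158]; [:: 72; 164]; [:: 72; 190]; [:: 72; 262];
    [:: 74; 130]; [:: 74; 150]; [:: 74; 154]; [:: 74; 158]; [:: 74; 164]; [:: 74; 172];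
    [:: 74; 260]; [:: 76; 130]; [:: 76; 132]; [:: 76; 134]; [:: 76; 144]; [:: 76; 148];
    [:: 76; 154]; [:: 76; 174]; [:: 76; 256]; [:: 78; 128]; [:: 78; 134]; [:: 78; 150];
    [:: 78; 160]; [:: 78; 270]; [:: 80; 130]; [:: 80; 140]; [:: 80; 142]; [:: 80; 158];
    [:: 80; 164]; [:: 80; 166]; [:: 80; 260]; [:: 80; 302]; [:: 82; 142]; [:: 82; 144];
    [:: 82; 152]; [:: 82; 154]; [:: 82; 302]; [:: 82; 308]; [:: 84; 134]; [:: 84; 152];
    [:: 84; 160]; [:: 84; 276]; [:: 86; 130]; [:: 86; 134]; [:: 86; 160]; [:: 86; 172];
    [:: 86; 174]; [:: 86; 180]; [:: 86; 190]; [:: 86; 258]; [:: 86; 268]; [:: 88; 138];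
    [:: 88; 140]; [:: 88; 148]; [:: 88; 152]; [:: 88; 168]; [:: 88; 184]; [:: 88; 280];
    [:: 90; 130]; [:: 90; 152]; [:: 90; 160]; [:: 90; 176]; [:: 90; 178]; [:: 92; 130];
    [:: 92; 138]; [:: 92; 142]; [:: 92; 144]; [:: 92; 164]; [:: 92; 170]; [:: 92; 276];
    [:: 92; 284]; [:: 94; 128]; [:: 94; 140]; [:: 94; 152]; [:: 94; 174]; [:: 94; 180];
    [:: 94; 278]; [:: 96; 134]; [:: 96; 164]; [:: 98; 144]; [:: 100; 134]; [:: 100; 164];
    [:: 102; 132]; [:: 102; 136]; [:: 102; 142]; [:: 102; 150]; [:: 102; 172]; [:: 102; 176];
    [:: 104; 138]; [:: 104; 176]; [:: 104; 272]; [:: 106; 128]; [:: 106; 130]; [:: 106; 136];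
    [:: 106; 144]; [:: 106; 154]; [:: 106; 158]; [:: 106; 180]; [:: 106; 184]; [:: 106; 190];
    [:: 106; 296]; [:: 108; 128]; [:: 108; 132]; [:: 108; 146]; [:: 108; 148]; [:: 108; 152];
    [:: 108; 154]; [:: 110; 132]; [:: 110; 146]; [:: 110; 148]; [:: 110; 158]; [:: 110; 162];
    [:: 110; 258]; [:: 112; 128]; [:: 112; 130]; [:: 112; 268]; [:: 114; 128]; [:: 114; 146];
    [:: 114; 154]; [:: 114; 180]; [:: 118; 158]; [:: 118; 172]; [:: 118; 190]; [:: 120; 128];
    [:: 120; 134]; [:: 120; 138]; [:: 120; 144]; [:: 120; 158]; [:: 120; 160]; [:: 120; 316];
    [:: 122; 130]; [:: 122; 134]; [:: 122; 148]; [:: 122; 152]; [:: 122; 168]; [:: 122; 176];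
    [:: 122; 180]; [:: 124; 144]; [:: 124; 164]; [:: 124; 172]; [:: 124; 174]; [:: 124; 180];
    [:: 124; 182]; [:: 124; 188]; [:: 126; 142]; [:: 126; 146]; [:: 126; 152]; [:: 126; 158];
    [:: 126; 288]; [:: 130; 272]; [:: 136; 260]; [:: 142; 298]; [:: 142; 314]; [:: 144; 264];
    [:: 146; 262]; [:: 146; 272]; [:: 160; 258]; [:: 160; 260]; [:: 160; 264]; [:: 162; 256];
    [:: 170; 264]; [:: 172; 302]; [:: 176; 264]; [:: 180; 264]; [:: 180; 288]; [:: 182; 256];
    [:: 184; 260]; [:: 188; 272]; [:: 192; 266]; [:: 192; 272]; [:: 198; 258]; [:: 198; 276];
    [:: 206; 260]; [:: 210; 258]; [:: 212; 268]; [:: 214; 286]; [:: 216; 286]; [:: 226; 302];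
    [:: 228; 256]; [:: 228; 272]; [:: 232; 272]]%num.

(** For x = 63 most orbits are stored up to the Frobenius map, each entry standing for nine
    bases. *)
Definition frobenius_planes9_63 : seq (seq N) :=
  map (cons 1%num) [::
    [:: 2; 4]; [:: 2; 8]; [:: 2; 12]; [:: 2; 16]; [:: 2; 24]; [:: 2; 28]; [:: 2; 40];
    [:: 2; 44]; [:: 2; 52]; [:: 2; 72]; [:: 2; 88]; [:: 2; 104]; [:: 2; 128]; [:: 2; 144];
    [:: 2; 184]; [:: 2; 212]; [:: 2; 216]; [:: 2; 220]; [:: 2; 252]; [:: 4; 8]; [:: 6; 10];
    [:: 6; 120]; [:: 6; 144]; [:: 6; 152]; [:: 6; 176]; [:: 6; 186]; [:: 6; 208]; [:: 6; 216];
    [:: 8; 48]; [:: 8; 84]; [:: 8; 102]; [:: 8; 118]; [:: 8; 148]; [:: 8; 244]; [:: 10; 20];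
    [:: 10; 48]; [:: 12; 22]; [:: 12; 36]; [:: 12; 84]; [:: 12; 130]; [:: 12; 210]; [:: 14; 18];
    [:: 20; 42]; [:: 22; 44]; [:: 22; 46]; [:: 24; 64]; [:: 24; 134]; [:: 26; 70]; [:: 30; 68];
    [:: 36; 72]; [:: 46; 78]; [:: 46; 92]; [:: 48; 66]; [:: 48; 76]; [:: 50; 66]; [:: 50; 86];
    [:: 50; 158]; [:: 52; 66]; [:: 52; 92]; [:: 52; 140]; [:: 54; 90]; [:: 56; 72]; [:: 58; 76];
    [:: 64; 184]; [:: 68; 136]; [:: 78; 182]; [:: 80; 162]; [:: 86; 172]; [:: 98; 144];
    [:: 102; 142]; [:: 102; 170]; [:: 102; 172]; [:: 106; 160]; [:: 112; 144]; [:: 120; 128];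
    [:: 144; 264]; [:: 158; 264]; [:: 160; 264]; [:: 170; 264]; [:: 192; 264]; [:: 202; 264];
    [:: 222; 264]; [:: 232; 264]; [:: 238; 264]]%num.

(** Representatives taken as they are, without Frobenius images. *)
Definition other_planes9_63 : seq (seq N) :=
  map (cons 1%num) [::
    [:: 22; 42]; [:: 42; 92]; [:: 42; 220]; [:: 56; 70]; [:: 62; 88]; [:: 74; 144];
    [:: 98; 158]; [:: 120; 316]; [:: 204; 304]]%num.

Definition frobenius_solids9 : seq (seq (seq N)) :=
  map (map (cons 1%num)) [::
  [::
    [:: 2; 4; 56]; [:: 2; 4; 96]; [:: 2; 4; 144]; [:: 2; 8; 20]; [:: 2; 12; 20]; [:: 2; 12; 36];
    [:: 2; 12; 96]; [:: 2; 12; 116]; [:: 2; 20; 128]; [:: 2; 20; 200]; [:: 2; 24; 104];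
    [:: 2; 24; 128]; [:: 2; 36; 132]; [:: 2; 40; 88]; [:: 2; 44; 88]; [:: 2; 48; 220];
    [:: 2; 52; 76]; [:: 2; 52; 128]; [:: 2; 56; 80]; [:: 2; 56; 84]; [:: 2; 56; 128];
    [:: 2; 60; 68]; [:: 2; 68; 128]; [:: 2; 76; 152]; [:: 2; 80; 128]; [:: 2; 80; 160];
    [:: 2; 120; 260]; [:: 4; 10; 98]; [:: 4; 42; 82]; [:: 4; 234; 264]; [:: 4; 242; 264];
    [:: 6; 8; 48]; [:: 6; 8; 82]; [:: 6; 8; 242]; [:: 6; 10; 48]; [:: 6; 10; 66];
    [:: 6; 10; 96]; [:: 6; 16; 34]; [:: 6; 16; 40]; [:: 6; 58; 66]; [:: 6; 120; 128];
    [:: 8; 16; 66]; [:: 8; 16; 134]; [:: 8; 68; 146]; [:: 8; 84; 176]; [:: 8; 118; 144];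
    [:: 10; 20; 166]; [:: 10; 20; 228]; [:: 10; 20; 262]; [:: 10; 22; 128]; [:: 10; 50; 66];
    [:: 10; 84; 182]; [:: 10; 96; 160]; [:: 12; 48; 68]; [:: 12; 70; 130]; [:: 14; 32; 80];
    [:: 14; 48; 66]; [:: 14; 54; 68]; [:: 14; 144; 262]; [:: 16; 40; 74]; [:: 18; 32; 64];
    [:: 18; 38; 130]; [:: 18; 72; 128]; [:: 18; 164; 256]; [:: 20; 42; 134]; [:: 20; 98; 140];
    [:: 20; 104; 132]; [:: 22; 38; 76]; [:: 22; 42; 70]; [:: 22; 44; 76]; [:: 22; 46; 256];
    [:: 24; 40; 206]; [:: 24; 64; 128]; [:: 24; 102; 130]; [:: 26; 44; 128]; [:: 26; 98; 138];
    [:: 26; 136; 260]; [:: 28; 32; 66]; [:: 30; 32; 70]; [:: 30; 32; 72]; [:: 30; 32; 128];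
    [:: 30; 46; 78]; [:: 30; 110; 140]; [:: 34; 64; 128]; [:: 36; 72; 146]; [:: 36; 76; 152];
    [:: 40; 206; 264]; [:: 42; 72; 144]; [:: 42; 78; 156]; [:: 42; 86; 134]; [:: 46; 64; 128];
    [:: 46; 66; 132]; [:: 46; 202; 256]; [:: 48; 66; 132]; [:: 48; 74; 148]; [:: 48; 80; 134];
    [:: 48; 80; 136]; [:: 48; 80; 260]; [:: 48; 92; 132]; [:: 50; 72; 144]; [:: 50; 84; 152];
    [:: 52; 76; 154]; [:: 52; 78; 156]; [:: 52; 88; 128]; [:: 54; 66; 132]; [:: 54; 88; 128];
    [:: 54; 88; 132]; [:: 54; 88; 134]; [:: 54; 90; 128]; [:: 56; 84; 140]; [:: 58; 76; 132];
    [:: 60; 68; 144]; [:: 60; 90; 148]; [:: 62; 90; 260]; [:: 62; 92; 134]; [:: 86; 188; 264];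
    [:: 90; 132; 264]; [:: 90; 154; 262]; [:: 92; 132; 264]; [:: 106; 160; 264];
    [:: 114; 142; 260]; [:: 116; 132; 264]; [:: 124; 170; 260]; [:: 124; 188; 260]];
  [::
    [:: 2; 4; 112]; [:: 2; 8; 36]; [:: 2; 8; 48]; [:: 2; 8; 64]; [:: 2; 8; 148]; [:: 2; 12; 68];
    [:: 2; 16; 40]; [:: 2; 24; 36]; [:: 2; 24; 40]; [:: 2; 24; 100]; [:: 2; 28; 40];
    [:: 2; 28; 76]; [:: 2; 36; 88]; [:: 2; 40; 64]; [:: 2; 44; 72]; [:: 2; 44; 156];
    [:: 2; 48; 216]; [:: 2; 52; 132]; [:: 2; 56; 148]; [:: 2; 56; 152]; [:: 2; 60; 88];
    [:: 2; 72; 144]; [:: 2; 72; 152]; [:: 2; 88; 136]; [:: 2; 92; 132]; [:: 2; 116; 152];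
    [:: 4; 8; 48]; [:: 4; 74; 146]; [:: 6; 8; 64]; [:: 6; 8; 98]; [:: 6; 8; 112];
    [:: 6; 10; 210]; [:: 6; 32; 66]; [:: 6; 34; 64]; [:: 6; 42; 88]; [:: 6; 58; 64];
    [:: 6; 64; 136]; [:: 6; 74; 144]; [:: 8; 16; 32]; [:: 8; 36; 66]; [:: 8; 50; 260];
    [:: 8; 54; 66]; [:: 8; 86; 182]; [:: 8; 228; 256]; [:: 10; 22; 38]; [:: 10; 48; 80];
    [:: 10; 70; 146]; [:: 12; 20; 68]; [:: 12; 32; 66]; [:: 12; 34; 80]; [:: 12; 38; 84];
    [:: 12; 38; 86]; [:: 12; 50; 86]; [:: 12; 98; 164]; [:: 14; 16; 164]; [:: 14; 18; 36];
    [:: 14; 116; 128]; [:: 14; 176; 262]; [:: 18; 34; 68]; [:: 18; 36; 136]; [:: 18; 44; 74];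
    [:: 18; 108; 128]; [:: 18; 110; 132]; [:: 20; 66; 132]; [:: 20; 110; 142];
    [:: 20; 228; 256]; [:: 22; 40; 66]; [:: 22; 46; 78]; [:: 22; 46; 128]; [:: 22; 64; 130];
    [:: 22; 108; 142]; [:: 22; 230; 256]; [:: 24; 40; 130]; [:: 24; 42; 134]; [:: 24; 66; 132];
    [:: 26; 38; 68]; [:: 26; 38; 76]; [:: 26; 76; 172]; [:: 26; 102; 134]; [:: 28; 38; 76];
    [:: 28; 102; 142]; [:: 28; 134; 256]; [:: 32; 64; 146]; [:: 32; 158; 264]; [:: 36; 74; 156];
    [:: 40; 64; 130]; [:: 40; 64; 146]; [:: 40; 80; 144]; [:: 40; 84; 132]; [:: 40; 144; 264];
    [:: 42; 92; 144]; [:: 44; 70; 146]; [:: 44; 82; 128]; [:: 46; 90; 156]; [:: 46; 92; 128];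
    [:: 46; 94; 156]; [:: 48; 90; 142]; [:: 50; 86; 136]; [:: 52; 66; 132]; [:: 52; 88; 130];
    [:: 54; 64; 154]; [:: 58; 70; 142]; [:: 60; 64; 130]; [:: 60; 64; 132]; [:: 60; 84; 256];
    [:: 62; 64; 154]; [:: 62; 70; 136]; [:: 62; 70; 138]; [:: 76; 154; 256]; [:: 84; 162; 256];
    [:: 84; 178; 258]; [:: 84; 190; 264]; [:: 90; 138; 258]; [:: 98; 188; 260];
    [:: 100; 176; 262]; [:: 108; 132; 264]; [:: 112; 142; 262]; [:: 124; 180; 258];
    [:: 126; 142; 260]];
  [::
    [:: 2; 4; 8]; [:: 2; 4; 88]; [:: 2; 4; 104]; [:: 2; 8; 16]; [:: 2; 8; 52]; [:: 2; 8; 112];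
    [:: 2; 8; 128]; [:: 2; 8; 244]; [:: 2; 12; 64]; [:: 2; 12; 84]; [:: 2; 16; 172];
    [:: 2; 16; 200]; [:: 2; 20; 68]; [:: 2; 20; 72]; [:: 2; 28; 44]; [:: 2; 40; 216];
    [:: 2; 44; 132]; [:: 2; 44; 144]; [:: 2; 44; 212]; [:: 2; 56; 132]; [:: 2; 60; 72];
    [:: 2; 68; 144]; [:: 2; 72; 160]; [:: 2; 72; 260]; [:: 2; 84; 184]; [:: 2; 92; 140];
    [:: 2; 96; 144]; [:: 2; 104; 184]; [:: 2; 144; 260]; [:: 4; 8; 32]; [:: 4; 10; 162];
    [:: 4; 40; 90]; [:: 6; 8; 144]; [:: 6; 18; 106]; [:: 6; 40; 88]; [:: 6; 120; 130];
    [:: 8; 38; 70]; [:: 8; 64; 146]; [:: 8; 86; 166]; [:: 10; 18; 36]; [:: 10; 22; 226];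
    [:: 10; 52; 66]; [:: 10; 54; 70]; [:: 12; 22; 100]; [:: 12; 50; 66]; [:: 12; 112; 144];
    [:: 12; 118; 148]; [:: 14; 18; 70]; [:: 14; 50; 70]; [:: 14; 80; 178]; [:: 16; 34; 68];
    [:: 16; 44; 70]; [:: 18; 32; 70]; [:: 18; 36; 130]; [:: 18; 38; 76]; [:: 18; 38; 78];
    [:: 18; 44; 66]; [:: 18; 74; 134]; [:: 20; 32; 72]; [:: 20; 46; 72]; [:: 20; 70; 142];
    [:: 22; 36; 72]; [:: 22; 42; 66]; [:: 22; 44; 70]; [:: 22; 70; 142]; [:: 24; 34; 76];
    [:: 24; 40; 78]; [:: 24; 46; 64]; [:: 24; 108; 132]; [:: 26; 34; 74]; [:: 26; 44; 64];
    [:: 26; 44; 66]; [:: 26; 100; 128]; [:: 26; 110; 134]; [:: 28; 36; 72]; [:: 28; 98; 166];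
    [:: 28; 110; 162]; [:: 30; 38; 78]; [:: 30; 42; 66]; [:: 32; 82; 148]; [:: 32; 94; 158];
    [:: 34; 68; 146]; [:: 34; 70; 140]; [:: 34; 76; 154]; [:: 36; 68; 136]; [:: 36; 82; 128];
    [:: 38; 76; 152]; [:: 38; 80; 132]; [:: 38; 84; 148]; [:: 42; 82; 136]; [:: 42; 84; 142];
    [:: 42; 88; 152]; [:: 44; 90; 158]; [:: 44; 128; 256]; [:: 46; 222; 256]; [:: 48; 68; 156];
    [:: 48; 92; 134]; [:: 48; 208; 256]; [:: 50; 66; 132]; [:: 50; 70; 156]; [:: 50; 86; 158];
    [:: 50; 88; 130]; [:: 52; 72; 132]; [:: 58; 64; 142]; [:: 58; 66; 132]; [:: 58; 70; 134];
    [:: 58; 74; 148]; [:: 60; 64; 128]; [:: 60; 70; 128]; [:: 60; 70; 146]; [:: 62; 64; 142];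
    [:: 62; 66; 152]; [:: 62; 70; 140]; [:: 66; 160; 258]; [:: 76; 152; 256]; [:: 80; 158; 260];
    [:: 94; 132; 264]; [:: 122; 180; 256]; [:: 124; 182; 256]];
  [::
    [:: 2; 4; 184]; [:: 2; 8; 84]; [:: 2; 12; 16]; [:: 2; 12; 52]; [:: 2; 16; 72];
    [:: 2; 16; 100]; [:: 2; 16; 168]; [:: 2; 20; 100]; [:: 2; 24; 64]; [:: 2; 24; 76];
    [:: 2; 28; 204]; [:: 2; 36; 152]; [:: 2; 36; 216]; [:: 2; 44; 64]; [:: 2; 44; 76];
    [:: 2; 44; 220]; [:: 2; 52; 68]; [:: 2; 56; 72]; [:: 2; 68; 136]; [:: 2; 72; 148];
    [:: 2; 72; 156]; [:: 2; 76; 132]; [:: 2; 120; 128]; [:: 2; 120; 176]; [:: 4; 10; 146];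
    [:: 6; 8; 18]; [:: 6; 8; 34]; [:: 6; 10; 114]; [:: 6; 18; 104]; [:: 6; 24; 40];
    [:: 6; 42; 90]; [:: 6; 56; 66]; [:: 6; 120; 138]; [:: 8; 16; 34]; [:: 8; 18; 64];
    [:: 8; 18; 130]; [:: 10; 20; 68]; [:: 10; 20; 134]; [:: 10; 36; 64]; [:: 10; 52; 86];
    [:: 10; 100; 164]; [:: 10; 160; 258]; [:: 10; 180; 258]; [:: 12; 20; 38]; [:: 12; 20; 96];
    [:: 12; 48; 80]; [:: 14; 16; 68]; [:: 14; 38; 64]; [:: 14; 52; 66]; [:: 14; 82; 180];
    [:: 14; 118; 134]; [:: 16; 34; 70]; [:: 16; 72; 130]; [:: 16; 74; 134]; [:: 18; 36; 72];
    [:: 18; 36; 74]; [:: 18; 46; 70]; [:: 18; 76; 256]; [:: 18; 98; 130]; [:: 18; 110; 162];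
    [:: 20; 40; 72]; [:: 20; 44; 76]; [:: 22; 46; 66]; [:: 22; 46; 130]; [:: 22; 72; 134];
    [:: 22; 98; 166]; [:: 22; 106; 134]; [:: 22; 160; 258]; [:: 24; 38; 64]; [:: 24; 42; 66];
    [:: 24; 46; 66]; [:: 24; 206; 264]; [:: 26; 36; 66]; [:: 26; 46; 70]; [:: 26; 78; 134];
    [:: 28; 44; 76]; [:: 28; 96; 132]; [:: 28; 96; 160]; [:: 30; 34; 68]; [:: 30; 36; 76];
    [:: 32; 66; 152]; [:: 32; 86; 258]; [:: 32; 94; 128]; [:: 34; 94; 134]; [:: 36; 70; 130];
    [:: 36; 74; 148]; [:: 38; 78; 158]; [:: 38; 86; 144]; [:: 40; 66; 150]; [:: 40; 80; 136];
    [:: 42; 84; 134]; [:: 44; 74; 148]; [:: 44; 78; 138]; [:: 44; 86; 128]; [:: 46; 66; 152];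
    [:: 46; 76; 138]; [:: 46; 86; 130]; [:: 52; 92; 142]; [:: 52; 148; 264]; [:: 54; 90; 130];
    [:: 56; 68; 136]; [:: 56; 80; 130]; [:: 56; 88; 152]; [:: 58; 70; 140]; [:: 60; 66; 134];
    [:: 60; 70; 134]; [:: 60; 86; 130]; [:: 68; 142; 260]; [:: 72; 172; 256]; [:: 74; 134; 256];
    [:: 80; 128; 258]; [:: 80; 128; 262]; [:: 80; 146; 258]; [:: 86; 160; 258];
    [:: 98; 132; 264]; [:: 104; 186; 260]; [:: 110; 132; 264]; [:: 120; 128; 258]]]%num.

(** Additions to the four parts of [frobenius_solids9], in the same order; the two middle parts
    consist of Frobenius images alone. *)
Definition other_solids9 : seq (seq (seq N)) :=
  map (map (cons 1%num)) [::
  [::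
    [:: 14; 18; 68]; [:: 28; 32; 192]; [:: 28; 44; 142]; [:: 48; 82; 130]; [:: 62; 84; 140];
    [:: 62; 88; 134]];
  [::
   ];
  [::
   ];
  [::
    [:: 2; 56; 68]; [:: 8; 98; 150]; [:: 14; 38; 128]; [:: 18; 110; 128]; [:: 26; 66; 132];
    [:: 28; 40; 70]; [:: 30; 34; 66]; [:: 62; 88; 130]; [:: 76; 142; 262]]]%num.

(* Images of the bases under the powers of the Frobenius map [x -> x ^ 2]. *)
Definition frobenius_images (bs : seq (seq N)) : seq (seq N) :=
  let t := log_table 8 529 511 in
  let e := exp_table 8 529 511 in
  let frobenius x := lookup e ((2 * lookup t x) mod 511)%num in
  flatten [seq traject (map frobenius) b 9 | b <- bs].

(** Nothing is proved about the Frobenius map: the expanded bases undergo the same checks as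
    explicit ones. *)
Definition planes9_63 : seq (seq N) :=
  frobenius_images frobenius_planes9_63 ++ other_planes9_63.

Definition solids9 : seq (seq (seq N)) :=
  [seq frobenius_images p.1 ++ p.2 | p <- zip frobenius_solids9 other_solids9].

(** * Running the checks *)

Lemma primitive7 : primitive 6 131 127.
Proof. by vm_compute. Qed.

Lemma log_table7 : log_table_ok 6 131 127.
Proof. by vm_compute. Qed.

Lemma planes7_ok : parts_ok 6 131 127 3 planes7 [:: 4; 4; 3; 5]%N.
Proof. by vm_compute. Qed.

Lemma planes7_counts : point_counts 6 131 127 planes7 = [:: 84; 84; 63; 105]%N.
Proof. by vm_compute. Qed.

Lemma solids7_ok : parts_ok 6 131 127 4 solids7 [:: 20; 20; 15; 25]%N.
Proof. by vm_compute. Qed.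

Lemma planes7_14_ok : parts_ok 6 131 127 3 planes7_14 [:: 14]%N.
Proof. by vm_compute. Qed.

Lemma planes7_14_counts : point_counts 6 131 127 planes7_14 = [:: 294]%N.
Proof. by vm_compute. Qed.

Lemma solids7_70_ok : parts_ok 6 131 127 4 solids7_70 [:: 70]%N.
Proof. by vm_compute. Qed.

Lemma primitive9 : primitive 8 529 511.
Proof. by vm_compute. Qed.

Lemma log_table9 : log_table_ok 8 529 511.
Proof. by vm_compute. Qed.

Lemma planes9_ok : parts_ok 8 529 511 3 planes9 [:: 22; 21]%N.
Proof. by vm_compute. Qed.

Lemma planes9_counts : point_counts 8 529 511 planes9 = [:: 1870; 1785]%N.
Proof. by vm_compute. Qed.

Lemma planes9_42_ok : parts_ok 8 529 511 3 [:: planes9_42] [:: 42]%N.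
Proof. by vm_compute. Qed.

Lemma planes9_42_counts : point_counts 8 529 511 [:: planes9_42] = [:: 3570]%N.
Proof. by vm_compute. Qed.

Lemma planes9_63_ok : parts_ok 8 529 511 3 [:: planes9_63] [:: 63]%N.
Proof. by vm_compute. Qed.

Lemma planes9_63_counts : point_counts 8 529 511 [:: planes9_63] = [:: 5355]%N.
Proof. by vm_compute. Qed.

Lemma solids9_ok : parts_ok 8 529 511 4 solids9 [:: 462; 441; 441; 441]%N.
Proof. by vm_compute. Qed.

Theorem corollary17 :
  (forall lambda : nat,
     lambda \in [:: 63; 84; 147; 168; 189; 252; 273; 294]%N ->
     exists (V : vectType 'F_2) (B : {fset {vspace V}}),
       subspace_design 2 8 4 lambda B) /\
  (forall lambda : nat,
     lambda \in [:: 1785; 1870; 3570; 3655; 5355]%N ->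
     exists (V : vectType 'F_2) (B : {fset {vspace V}}),
       subspace_design 2 10 4 lambda B).
Proof.
(* The parts of [planes7] and [solids7] correspond, with y = 5x in each, so one mask serves for
   both. *)
have d8 ms := design_of_parts (k := 3) (ms := ms) (ns := ms) primitive7 log_table7 isT
  planes7_ok planes7_counts solids7_ok.
have d8_14 := design_of_parts (k := 3) (ms := [:: true]) (ns := [:: true])
  primitive7 log_table7 isT planes7_14_ok planes7_14_counts solids7_70_ok.
have d10 ms ns := design_of_parts (k := 3) (ms := ms) (ns := ns) primitive9 log_table9 isT
  planes9_ok planes9_counts solids9_ok.
(* Two parts of solids give y = 2 * 441 = 21 * 42; three of them give y = 21 * 63 for the next
   family. *)
have d10_42 := design_of_parts (k := 3) (ms := [:: true]) (ns := [:: false; true; true; false])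
  primitive9 log_table9 isT planes9_42_ok planes9_42_counts solids9_ok.
have d10_63 := design_of_parts (k := 3) (ms := [:: true]) (ns := [:: false; true; true; true])
  primitive9 log_table9 isT planes9_63_ok planes9_63_counts solids9_ok.
split=> lambda.
  (* The masks realize x = 3, 4, 7, 8, 9, 12, 13 from the parts 4, 4, 3, 5, with lambda = 21x. *)
  rewrite in_cons => /predU1P[->|]; first exact: (d8 _ [:: false; false; true; false] erefl erefl).
  rewrite in_cons => /predU1P[->|]; first exact: (d8 _ [:: true; false; false; false] erefl erefl).
  rewrite in_cons => /predU1P[->|]; first exact: (d8 _ [:: true; false; true; false] erefl erefl).
  rewrite in_cons => /predU1P[->|]; first exact: (d8 _ [:: true; true; false; false] erefl erefl).
  rewrite in_cons => /predU1P[->|]; first exact: (d8 _ [:: true; false; false; true] erefl erefl).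
  rewrite in_cons => /predU1P[->|]; first exact: (d8 _ [:: true; false; true; true] erefl erefl).
  rewrite in_cons => /predU1P[->|]; first exact: (d8 _ [:: true; true; false; true] erefl erefl).
  by rewrite mem_seq1 => /eqP->; exact: (d8_14 _ erefl erefl).
(* Here lambda = 85x; the parts 22 and 21 of planes go with the parts 462 and 441 of solids, 21
   times as large. *)
rewrite in_cons => /predU1P[->|].
  exact: (d10 _ [:: false; true] [:: false; true; false; false] erefl erefl).
rewrite in_cons => /predU1P[->|].
  exact: (d10 _ [:: true; false] [:: true; false; false; false] erefl erefl).
rewrite in_cons => /predU1P[->|]; first exact: (d10_42 _ erefl erefl).
rewrite in_cons => /predU1P[->|].
  exact: (d10 _ [:: true; true] [:: true; true; false; false] erefl erefl).
by rewrite mem_seq1 => /eqP->; exact: (d10_63 _ erefl erefl).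
Qed.
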